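(* Let $d\in\mathbb N$, let $A$ be a real $d\times d$ diagonalizable matrix with positive eigenvalues, and suppose that all eigenvectors of $A$ belong to an open set $V$ in $\mathbb R^d$. Consider the equation $y'+Ay=F(y)$, $t>0$, in $\mathbb R^d$. The spaces $\mathcal X(V),\mathcal X^0(V),\widehat{\mathcal X}(V),\widehat{\mathcal X}^0(V)$ and the properties ''infinite expansion property'' and ''finite expansion property'' are those defined in the context. (i) If $F\in\mathcal X(V)$, then every solution $y\in C^1([0,\infty),\mathbb R^d)$ of the equation with $y(0)\ne0$ and $\lim_{t\to\infty}y(t)=0$ has the infinite expansion property. If $F\in\widehat{\mathcal X}(V)$, then every such solution has the finite expansion property. (ii) Let $y\in C^1([0,\infty),\mathbb R^d)$ be a solution of the equation such that $y(t)\to0$ as $t\to\infty$ and there is a divergent, strictly increasing sequence $(t_n)_{n=1}^\infty$ in $(0,\infty)$ with $y(t_n)\ne0$ for all $n\in\mathbb N$. If $F\in\mathcal X^0(V)$, then $y$ has the infinite expansion property. If $F\in\widehat{\mathcal X}^0(V)$, then $y$ has the finite expansion property.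
   Context: $|\cdot|$ is the Euclidean norm; $\mathbb Z_+=\{0,1,2,\dots\}$; $I_d$ is the identity matrix. For $t$-dependent functions, $f(t)=\mathcal O(h(t))$ means $|f(t)|\le Ch(t)$ for all sufficiently large $t$, for some $C>0$; ''$f(x)=\mathcal O(h(x))$ as $x\to0$'' means there are $r,C>0$ with $|f(x)|\le Ch(x)$ for all $|x|<r$. $\mathcal H_\beta(\mathbb R^d)$ is the set of $G:\mathbb R^d\to\mathbb R^d$ with $G(tx)=t^\beta G(x)$ for all $x\in\mathbb R^d$, $t>0$. ''$G\in C^\infty(V)$'' means that $G$ restricted to $V$ is infinitely differentiable. The distinct eigenvalues of $A$ are $0<\lambda_1<\dots<\lambda_{d_*}$. Function spaces. Consider the following types of approximation of a function $F:\mathbb R^d\to\mathbb R^d$, where all $F_k\in\mathcal H_{\beta_k}(\mathbb R^d)\cap C^\infty(V)$: (E1) numbers $\beta_k\in(1,\infty)$, $k\in\mathbb N$, strictly increasing to infinity, and functions $F_k$, $k\in\mathbb N$, such that for every $N\in\mathbb N$, $|F(x)-\sum_{k=1}^NF_k(x)|=\mathcal O(|x|^\beta)$ as $x\to0$ for some $\beta>\beta_N$; (E2) $N_*\in\mathbb N$, strictly increasing $\beta_1,\dots,\beta_{N_*}\in(1,\infty)$ and functions $F_1,\dots,F_{N_*}$ such that $|F(x)-\sum_{k=1}^{N_*}F_k(x)|=\mathcal O(|x|^\beta)$ as $x\to0$ for all $\beta>\beta_{N_*}$; (E3) $N_*\in\mathbb N$, strictly increasing $\beta_1,\dots,\beta_{N_*}\in(1,\infty)$,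 functions $F_1,\dots,F_{N_*}$ and a number $\bar\varepsilon>0$ such that $|F(x)-\sum_{k=1}^{N_*}F_k(x)|=\mathcal O(|x|^{\beta_{N_*}+\bar\varepsilon})$ as $x\to0$. $\mathcal X(V)$ (respectively $\mathcal X^0(V)$) is the set of locally Lipschitz (respectively continuous) functions $F:\mathbb R^d\to\mathbb R^d$ having an approximation of type (E1) or (E2). $\widehat{\mathcal X}(V)$ (respectively $\widehat{\mathcal X}^0(V)$) is the set of locally Lipschitz (respectively continuous) functions $F:\mathbb R^d\to\mathbb R^d$ having an approximation of type (E3). In what follows, such an approximation of $F$ is given. Data attached to a solution. Given an eigenvalue $\lambda_*=\lambda_{n_0}$ of $A$ and a corresponding eigenvector $\xi_*$, put $\alpha_k=\beta_k-1$ and let $\tilde S$ be the set of all numbers $\sum_{k=n_0}^{d_*}m_k(\lambda_k-\lambda_* )+\sum_jz_j\alpha_j\lambda_*$ with $m_k,z_j\in\mathbb Z_+$, where $j$ ranges over $\mathbb N$ with only finitely many $z_j>0$ in case (E1), and over $1,\dots,N_*$ in cases (E2), (E3). Arrange $\tilde S$ as a strictly increasing sequence $(\tilde\mu_n)_{n=1}^\infty$ and set $\mu_n=\tilde\mu_n+\lambda_*$. For $m\ge0$ let $\mathcal F_{r,m}=\frac1{m!}D^mF_r(\xi_* )$ (the $m$-th derivative of $F_r$ at $\xi_*$ divided by $m!$, an $m$-linear map $(\mathbb R^d)^m\to\mathbb R^d$; $\mathcal F_{r,0}=F_r(\xi_* )$). Consider the equation $$(Q_n)\qquad q_n'+(A-\mu_nI_d)q_n=\sum_{\substack{r\ge1,\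 m\ge0,\ k_1,\dots,k_m\ge2,\\ \sum_{j=1}^m\tilde\mu_{k_j}+\alpha_r\lambda_*=\tilde\mu_n}}\mathcal F_{r,m}(q_{k_1},\dots,q_{k_m})\quad\text{in }\mathbb R,$$ where $r$ ranges over $\mathbb N$ in case (E1) and over $1,\dots,N_*$ in cases (E2), (E3); the sum is over all $r$, $m$ and ordered tuples satisfying the constraint (a finite sum); for $m=0$ the constraint is $\alpha_r\lambda_*=\tilde\mu_n$ and the term is $F_r(\xi_* )$; an empty sum is zero. Infinite expansion property of $y$ (for approximations (E1) or (E2)): there exist an eigenvalue $\lambda_*=\lambda_{n_0}$ of $A$ and a corresponding eigenvector $\xi_*$ with $|y(t)-e^{-\lambda_*t}\xi_*|=\mathcal O(e^{-(\lambda_*+\delta)t})$ for some $\delta>0$, and polynomials $q_n:\mathbb R\to\mathbb R^d$, $n\in\mathbb N$, satisfying $(Q_n)$ for all $n\ge1$, such that for every $N\ge1$ there is $\varepsilon_N>0$ with $|y(t)-\sum_{n=1}^Nq_n(t)e^{-\mu_nt}|=\mathcal O(e^{-(\mu_N+\varepsilon_N)t})$. Finite expansion property of $y$ (for approximation (E3)): there exist an eigenvalue $\lambda_*=\lambda_{n_0}$ of $A$ and a corresponding eigenvector $\xi_*$ with $|y(t)-e^{-\lambda_*t}\xi_*|=\mathcal O(e^{-(\lambda_*+\delta_0)t})$ for some $\delta_0>0$, and, with $\bar N=\max\{N\in\mathbb N:\lambda_*(\beta_{N_*}+\bar\varepsilon)>\mu_N\}$, polynomials $q_n:\mathbb R\to\mathbb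 R^d$, $1\le n\le\bar N$, satisfying $(Q_n)$ for $1\le n\le\bar N$, and $\delta>0$ such that $|y(t)-\sum_{n=1}^{\bar N}q_n(t)e^{-\mu_nt}|=\mathcal O(e^{-(\mu_{\bar N}+\delta)t})$. *)

(* Defs.v *)
From HB Require Import structures.
From mathcomp Require Import all_boot all_order all_algebra.
From mathcomp Require Import all_classical all_reals all_analysis.
Set Implicit Arguments.
Unset Strict Implicit.
Unset Printing Implicit Defensive.
Import Order.TTheory GRing.Theory Num.Theory.
Import numFieldNormedType.Exports.
Local Open Scope classical_set_scope.
Local Open Scope ring_scope.

(* The library norm of 'cV[R]_d is the sup norm; it is used only through
   notions which do not depend on the choice of the norm (limits, continuity,
   derivatives, local Lipschitz continuity). Quantitative bounds use enorm. *)
Definition enorm (R : realType) (d : nat) (v : 'cV[R]_d) : R :=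
  Num.sqrt (\sum_(i < d) v i ord0 ^+ 2).

Definition bigO_infty (R : realType) (d : nat)
    (f : R -> 'cV[R]_d) (h : R -> R) : Prop :=
  exists2 C : R, 0 < C & \forall t \near +oo, enorm (f t) <= C * h t.

Definition bigO_zero (R : realType) (d : nat)
    (f : 'cV[R]_d -> 'cV[R]_d) (h : 'cV[R]_d -> R) : Prop :=
  exists r C : R, [/\ 0 < r, 0 < C &
    forall x, enorm x < r -> enorm (f x) <= C * h x].

Definition homogeneous (R : realType) (d : nat) (beta : R)
    (G : 'cV[R]_d -> 'cV[R]_d) : Prop :=
  forall (x : 'cV[R]_d) (t : R), 0 < t -> G (t *: x) = (t `^ beta) *: G x.

Definition locally_lipschitz (R : realType) (d : nat)
    (F : 'cV[R]_d -> 'cV[R]_d) : Prop :=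
  forall x : 'cV[R]_d, exists2 U : set 'cV[R]_d, nbhs x U & [lipschitz F z | z in U].

(* f is of class C^k on the open set V. In finite dimension, continuity (resp.
   class C^k) of x |-> 'd f x in operator norm amounts to that of
   x |-> 'd f x v for every v. *)
Fixpoint class_C (R : realType) (U W : normedModType R) (k : nat) (V : set U)
    (f : U -> W) : Prop :=
  if k is k'.+1 then
    (forall x, V x -> differentiable f x) /\
    (forall v : U, class_C k' V (fun x => 'd f x v))
  else forall x, V x -> {for x, continuous f}.

Definition smooth_on (R : realType) (U W : normedModType R) (V : set U)
    (f : U -> W) : Prop := forall k, class_C k V f.

(* D^m f (x) (v_1, ..., v_m) for s = [:: v_1; ...; v_m]. *)
Fixpoint iter_diff (R : realType) (U W : normedModType R) (f : U -> W)
    (s : seq U) : U -> W :=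
  if s is v :: s' then fun x => 'd (iter_diff f s') x v else f.

Definition taylor_coef (R : realType) (d : nat) (G : 'cV[R]_d -> 'cV[R]_d)
    (x : 'cV[R]_d) (s : seq 'cV[R]_d) : 'cV[R]_d :=
  ((size s)`!%:R)^-1 *: iter_diff G s x.

(* Sequences are indexed from 1; their value at 0 is never used.
   The terms of an approximation have indices 1, 2, ... for K = None and
   1, ..., N for K = Some N. *)
Definition in_range (K : option nat) (k : nat) : bool :=
  (0 < k)%N && (if K is Some N then (k <= N)%N else true).

Definition approx_terms (R : realType) (d : nat) (V : set 'cV[R]_d)
    (K : option nat) (beta : nat -> R) (G : nat -> 'cV[R]_d -> 'cV[R]_d) :
    Prop :=
  [/\ forall k, in_range K k -> 1 < beta k,
      forall j k, in_range K j -> in_range K k -> (j < k)%N -> beta j < beta k,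
      forall k, in_range K k -> homogeneous (beta k) (G k) &
      forall k, in_range K k -> smooth_on V (G k)].

Definition remainder_bound (R : realType) (d : nat)
    (F : 'cV[R]_d -> 'cV[R]_d) (G : nat -> 'cV[R]_d -> 'cV[R]_d) (N : nat)
    (b : R) : Prop :=
  bigO_zero (fun x => F x - \sum_(1 <= k < N.+1) G k x)
            (fun x => enorm x `^ b).

Definition infinite_approx (R : realType) (d : nat) (V : set 'cV[R]_d)
    (F : 'cV[R]_d -> 'cV[R]_d) (beta : nat -> R)
    (G : nat -> 'cV[R]_d -> 'cV[R]_d) : Prop :=
  [/\ approx_terms V None beta G,
      beta @ \oo --> +oo &
      forall N, (0 < N)%N -> exists2 b, beta N < b & remainder_bound F G N b].

Definition terminating_approx (R : realType) (d : nat) (V : set 'cV[R]_d)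
    (F : 'cV[R]_d -> 'cV[R]_d) (Ns : nat) (beta : nat -> R)
    (G : nat -> 'cV[R]_d -> 'cV[R]_d) : Prop :=
  [/\ (0 < Ns)%N,
      approx_terms V (Some Ns) beta G &
      forall b, beta Ns < b -> remainder_bound F G Ns b].

Definition finite_approx (R : realType) (d : nat) (V : set 'cV[R]_d)
    (F : 'cV[R]_d -> 'cV[R]_d) (Ns : nat) (beta : nat -> R)
    (G : nat -> 'cV[R]_d -> 'cV[R]_d) (eps : R) : Prop :=
  [/\ (0 < Ns)%N,
      approx_terms V (Some Ns) beta G,
      0 < eps &
      remainder_bound F G Ns (beta Ns + eps)].

Definition full_approx (R : realType) (d : nat) (V : set 'cV[R]_d)
    (F : 'cV[R]_d -> 'cV[R]_d) (K : option nat) (beta : nat -> R)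
    (G : nat -> 'cV[R]_d -> 'cV[R]_d) : Prop :=
  if K is Some Ns then terminating_approx V F Ns beta G
  else infinite_approx V F beta G.

Definition calX (R : realType) (d : nat) (V : set 'cV[R]_d) :
    set ('cV[R]_d -> 'cV[R]_d) :=
  [set F | locally_lipschitz F /\
           exists K beta G, full_approx V F K beta G].

Definition calX0 (R : realType) (d : nat) (V : set 'cV[R]_d) :
    set ('cV[R]_d -> 'cV[R]_d) :=
  [set F | continuous F /\ exists K beta G, full_approx V F K beta G].

Definition calXhat (R : realType) (d : nat) (V : set 'cV[R]_d) :
    set ('cV[R]_d -> 'cV[R]_d) :=
  [set F | locally_lipschitz F /\
           exists Ns beta G eps, finite_approx V F Ns beta G eps].

Definition calXhat0 (R : realType) (d : nat) (V : set 'cV[R]_d) :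
    set ('cV[R]_d -> 'cV[R]_d) :=
  [set F | continuous F /\
           exists Ns beta G eps, finite_approx V F Ns beta G eps].

(* The library's eigenvalue refers to row eigenvectors; a square matrix has the
   same eigenvalues on either side. *)
Definition eigenvector (R : realType) (d : nat) (A : 'M[R]_d) (a : R)
    (v : 'cV[R]_d) : Prop :=
  v != 0 /\ A *m v = a *: v.

Definition distinct_eigenvalues (R : realType) (d : nat) (A : 'M[R]_d)
    (dstar : nat) (lam : nat -> R) : Prop :=
  (forall j k, (0 < j)%N -> (j < k)%N -> (k <= dstar)%N -> lam j < lam k) /\
  (forall a, eigenvalue A a <-> exists2 k, (0 < k <= dstar)%N & a = lam k).

(* Only the values z 1, ..., z L enter: this encodes the finite support of z. *)
Definition Stilde (R : realType) (dstar : nat) (lam : nat -> R) (n0 : nat)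
    (K : option nat) (beta : nat -> R) : set R :=
  [set s | exists (m z : nat -> nat) (L : nat),
     s = \sum_(n0 <= k < dstar.+1) (m k)%:R * (lam k - lam n0)
       + \sum_(1 <= j < L.+1 | in_range K j)
           (z j)%:R * (beta j - 1) * lam n0].

Definition enumerates (R : realType) (mut : nat -> R) (S : set R) : Prop :=
  (forall n, (0 < n)%N -> mut n < mut n.+1) /\
  (forall s, S s <-> exists2 n, (0 < n)%N & s = mut n).

Definition vector_polynomial (R : realType) (d : nat) (q : R -> 'cV[R]_d) :
    Prop :=
  exists p : 'cV[{poly R}]_d, forall t, q t = map_mx (horner^~ t) p.

(* Pairs (r, [:: k_1; ...; k_m]). *)
Definition resonant_indices (R : realType) (ls : R) (K : option nat)
    (beta : nat -> R) (mut : nat -> R) (n : nat) : set (nat * seq nat) :=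
  [set p | [/\ in_range K p.1, all (leq 2) p.2 &
     \sum_(k <- p.2) mut k + (beta p.1 - 1) * ls = mut n]].

(* The sum over p \in D is the library's finitely supported sum; here the index
   set is finite. *)
Definition Q_equation (R : realType) (d : nat) (A : 'M[R]_d) (ls : R)
    (xi : 'cV[R]_d) (K : option nat) (beta : nat -> R)
    (G : nat -> 'cV[R]_d -> 'cV[R]_d) (mut : nat -> R)
    (q : nat -> R -> 'cV[R]_d) (n : nat) : Prop :=
  forall t : R,
    derive1 (q n) t + (A - (mut n + ls)%:M) *m q n t =
    \sum_(p \in resonant_indices ls K beta mut n)
      taylor_coef (G p.1) xi [seq q k t | k <- p.2].

Definition leading_term (R : realType) (d : nat) (A : 'M[R]_d) (ls : R)
    (xi : 'cV[R]_d) (y : R -> 'cV[R]_d) : Prop :=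
  eigenvector A ls xi /\
  exists2 delta : R, 0 < delta &
    bigO_infty (fun t => y t - expR (- ls * t) *: xi)
               (fun t => expR (- (ls + delta) * t)).

Definition partial_expansion (R : realType) (d : nat) (ls : R)
    (mut : nat -> R) (q : nat -> R -> 'cV[R]_d) (N : nat)
    (y : R -> 'cV[R]_d) : Prop :=
  exists2 eps : R, 0 < eps &
    bigO_infty
      (fun t => y t - \sum_(1 <= n < N.+1) expR (- (mut n + ls) * t) *: q n t)
      (fun t => expR (- (mut N + ls + eps) * t)).

Definition infinite_expansion_property (R : realType) (d : nat) (A : 'M[R]_d)
    (dstar : nat) (lam : nat -> R) (K : option nat) (beta : nat -> R)
    (G : nat -> 'cV[R]_d -> 'cV[R]_d) (y : R -> 'cV[R]_d) : Prop :=
  exists n0 : nat, (0 < n0 <= dstar)%N /\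
  exists xi : 'cV[R]_d, leading_term A (lam n0) xi y /\
  exists mut : nat -> R, enumerates mut (Stilde dstar lam n0 K beta) /\
  exists q : nat -> R -> 'cV[R]_d,
    [/\ forall n, (0 < n)%N -> vector_polynomial (q n),
        forall n, (0 < n)%N -> Q_equation A (lam n0) xi K beta G mut q n &
        forall N, (0 < N)%N -> partial_expansion (lam n0) mut q N y].

Definition finite_expansion_property (R : realType) (d : nat) (A : 'M[R]_d)
    (dstar : nat) (lam : nat -> R) (Ns : nat) (beta : nat -> R)
    (G : nat -> 'cV[R]_d -> 'cV[R]_d) (eps : R) (y : R -> 'cV[R]_d) : Prop :=
  exists n0 : nat, (0 < n0 <= dstar)%N /\
  exists xi : 'cV[R]_d, leading_term A (lam n0) xi y /\
  exists mut : nat -> R,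
    enumerates mut (Stilde dstar lam n0 (Some Ns) beta) /\
  exists Nbar : nat,
    [/\ (0 < Nbar)%N,
        mut Nbar + lam n0 < lam n0 * (beta Ns + eps) &
        forall N, (0 < N)%N ->
          mut N + lam n0 < lam n0 * (beta Ns + eps) -> (N <= Nbar)%N] /\
  exists q : nat -> R -> 'cV[R]_d,
    [/\ forall n, (0 < n <= Nbar)%N -> vector_polynomial (q n),
        forall n, (0 < n <= Nbar)%N ->
          Q_equation A (lam n0) xi (Some Ns) beta G mut q n &
        partial_expansion (lam n0) mut q Nbar y].

(* y belongs to C^1([0,oo)), with a one-sided derivative at 0; the values of y
   on negative numbers are irrelevant. *)
Definition C1_halfline (R : realType) (d : nat) (y : R -> 'cV[R]_d) : Prop :=
  exists dy : R -> 'cV[R]_d,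
    [/\ {within [set t : R | 0 <= t], continuous dy},
        forall t : R, 0 < t -> is_derive t (1 : R) y (dy t) &
        h^-1 *: (y h - y 0) @[h --> 0^'+] --> dy 0].

Definition is_solution (R : realType) (d : nat) (A : 'M[R]_d)
    (F : 'cV[R]_d -> 'cV[R]_d) (y : R -> 'cV[R]_d) : Prop :=
  C1_halfline y /\ forall t : R, 0 < t -> derive1 y t + A *m y t = F (y t).

(* Main.v *)
Require Import Defs.
From HB Require Import structures.
From mathcomp Require Import all_boot all_order all_algebra.
From mathcomp Require Import all_classical all_reals all_analysis.
From mathcomp Require Import ring lra.
Set Implicit Arguments.
Unset Strict Implicit.
Unset Printing Implicit Defensive.
Import Order.TTheory GRing.Theory Num.Theory.
Import numFieldNormedType.Exports.
Local Open Scope classical_set_scope.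
Local Open Scope ring_scope.

(** Why the expansion exists.

    Diagonalize A by an invertible P: the coordinates u_i of P y satisfy the
    scalar equations u_i' + D_i u_i = f_i with f = P F(y).  The argument uses
    these equations and one fact about them ([scalar_ode_decay]): if
    u' + d u = O(e^{-rho t}) and rho' < rho, then u = c e^{-d t} + O(e^{-rho' t})
    for some constant c.  To see this, compare e^{d t} u with a
    primitive of the bound for its derivative.

    Size of F.  The homogeneous terms of the approximation are regular only near
    the eigenvectors, but they can be separated from one another by comparing
    the values of their sum at x and x/2; since the sum is bounded near 0, so is
    each of them, and |F(x)| <= C |x|^beta_1 near 0 with beta_1 > 1
    ([superlinear_bound]).

    Leading term.  As F is superlinear, the energy |P y|^2 decays exponentially,
    and its logarithmic derivative is bounded below, so that y does not decay
    faster than every exponential.  If y = O(e^{-a t}), then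
    F(y) = O(e^{-a beta_1 t}), and by the scalar fact either some coordinate of
    P y shows a mode c e^{-D_i t} with c <> 0, and the slowest of these is the
    leading term, or y = O(e^{-(a+kappa)t}) with kappa > 0 independent of a.  The
    second case cannot occur for ever ([leading_diagonal], [leading_exists]).

    Higher terms.  Write y = e^{-lambda t}(xi + eta), where eta -> 0.  By
    homogeneity G_r(y) = e^{-lambda beta_r t} G_r(xi + eta), and xi lies in the
    open set where G_r is smooth, so G_r(xi + eta) can be replaced by a Taylor
    polynomial at xi.  Inserting the expansion of eta known so far and using
    multilinearity, one obtains an expansion of F(y) one step further than that
    of y, whose coefficients are the right-hand sides of the equations for the
    q_n ([forcing_expansion]); the gain comes from the factor
    e^{-(beta_r - 1) lambda t}.  The next coefficient q_n is then found from the
    scalar equations, coordinate by coordinate ([scalar_ode_expansion],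
    [expansion_upto_step]).  No mode e^{-D_i t} can appear between two
    consecutive exponents, because the exponents mu_n contain the eigenvalues
    above lambda.

    Exponents.  The set of shifted exponents is the additive monoid generated by
    the numbers lambda_k - lambda and (beta_j - 1) lambda; only finitely many
    generators lie below any bound, so the monoid is locally finite and can be
    listed increasingly ([Stilde_enumeration]). *)

(** * Functions of exponential order *)

Definition expO (R : realType) (W : normedModType R) (a : R) (f : R -> W) :
    Prop :=
  exists C : R, \forall t \near +oo, `|f t| <= C * expR (- a * t).

(** The class of remainders: [f] beats e^{-at} by some exponential factor. The
    gain [e] is hidden in the definition because it shrinks at every step of
    the argument, for instance when a polynomial factor is absorbed. *)
Definition small (R : realType) (W : normedModType R) (a : R) (f : R -> W) :
    Prop :=
  exists2 e : R, 0 < e & expO (a + e) f.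

Section ExpO.
Context {R : realType}.
Implicit Types (W : normedModType R) (a b e : R).

Lemma near_pinfty_ge (a : R) : \forall t \near +oo, a <= t.
Proof. by apply: nbhs_pinfty_ge; exact: num_real. Qed.

Lemma expO_dom W W' a (f : R -> W) (g : R -> W') (K : R) :
  (\forall t \near +oo, `|g t| <= K * `|f t|) -> expO a f -> expO a g.
Proof.
move=> gf [C fC]; exists (`|K| * C).
near=> t.
apply: (@le_trans _ _ (K * `|f t|)); first by near: t.
apply: (@le_trans _ _ (`|K| * `|f t|)); first by rewrite ler_wpM2r// ler_norm.
by rewrite -mulrA ler_wpM2l//; near: t.
Unshelve. all: by end_near. Qed.

Lemma expO_eq W a (f g : R -> W) : f =1 g -> expO a f -> expO a g.
Proof. by move=> /funext ->. Qed.

Lemma expO_le W a b (f : R -> W) : a <= b -> expO b f -> expO a f.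
Proof.
move=> ab [C fC]; exists `|C|; near=> t.
apply: (@le_trans _ _ (C * expR (- b * t))); first by near: t.
apply: (@le_trans _ _ (`|C| * expR (- b * t))).
  by rewrite ler_wpM2r ?expR_ge0// ler_norm.
rewrite ler_wpM2l// ler_expR; apply: ler_wpM2r; last by rewrite lerN2.
by near: t; exact: near_pinfty_ge.
Unshelve. all: by end_near. Qed.

Lemma expO0 W a : expO a (fun=> 0 : W).
Proof. by exists 0; near=> t; rewrite normr0 mul0r. Unshelve. all: by end_near. Qed.

Lemma expOD W a (f g : R -> W) :
  expO a f -> expO a g -> expO a (fun t => f t + g t).
Proof.
move=> [C fC] [D gD]; exists (C + D); near=> t.
rewrite mulrDl (le_trans (ler_normD _ _))// lerD//; by near: t.
Unshelve. all: by end_near. Qed.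

Lemma expON W a (f : R -> W) : expO a f -> expO a (fun t => - f t).
Proof.
by apply: (@expO_dom _ _ _ _ _ 1); near=> t; rewrite normrN mul1r.
Unshelve. all: by end_near. Qed.

Lemma expO_sum W (I : eqType) (r : seq I) (P : pred I) a (f : I -> R -> W) :
  (forall i, i \in r -> P i -> expO a (f i)) ->
  expO a (fun t => \sum_(i <- r | P i) f i t).
Proof.
elim: r => [|i r IH] fa.
  by apply: (expO_eq _ (expO0 W a)) => t; rewrite big_nil.
have IHr : expO a (fun t => \sum_(j <- r | P j) f j t).
  by apply: IH => j jr; apply: fa; rewrite in_cons jr orbT.
have [Pi|nPi] := boolP (P i); last first.
  by apply: expO_eq IHr => t; rewrite big_cons (negbTE nPi).
have := expOD (fa i (mem_head _ _) Pi) IHr.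
by apply: expO_eq => t; rewrite big_cons Pi.
Qed.

Lemma expOM W a b (f : R -> R) (g : R -> W) :
  expO a f -> expO b g -> expO (a + b) (fun t => f t *: g t).
Proof.
move=> [C fC] [D gD]; exists (C * D); near=> t.
rewrite normrZ opprD mulrDl expRD mulrACA ler_pM//; by near: t.
Unshelve. all: by end_near. Qed.

Lemma expO_exp a : expO a (fun t : R => expR (- a * t)).
Proof.
exists 1; near=> t; by rewrite mul1r ger0_norm// expR_ge0.
Unshelve. all: by end_near. Qed.

Lemma expOZexp W a b (f : R -> W) :
  expO b f -> expO (a + b) (fun t => expR (- a * t) *: f t).
Proof. by apply: expOM; exact: expO_exp. Qed.

Lemma expO_id e : 0 < e -> expO (- e) (id : R -> R).
Proof.
move=> e0; exists e^-1; near=> t.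
have t0 : 0 <= t by near: t; exact: near_pinfty_ge.
rewrite opprK ger0_norm// ler_pdivlMl//.
by rewrite (le_trans _ (expR_ge1Dx _))// lerDr.
Unshelve. all: by end_near. Qed.

Lemma expO_cst W (w : W) : expO 0 (fun=> w).
Proof.
exists `|w|; near=> t; by rewrite oppr0 mul0r expR0 mulr1.
Unshelve. all: by end_near. Qed.

(** Polynomials cost an arbitrarily small exponential rate, since t <= e^{e t}
    / e. *)
Lemma expO_poly e (p : {poly R}) : 0 < e -> expO (- e) (fun t => p.[t]).
Proof.
elim/poly_ind: p e => [|p c IH] e e0.
  by apply: (expO_eq _ (expO0 _ _)) => t; rewrite horner0.
apply: (@expO_eq _ _ (fun t => (t * p.[t] : R) + c)).
  by move=> t; rewrite !hornerE mulrC.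
apply: expOD; last by apply: (expO_le _ (expO_cst _)); rewrite oppr_le0 ltW.
have e2 : 0 < e / 2 by rewrite divr_gt0.
have -> : - e = - (e / 2) + - (e / 2) by lra.
exact: (expOM (expO_id e2) (IH _ e2)).
Qed.

Lemma small_le W a b (f : R -> W) : a <= b -> small b f -> small a f.
Proof.
move=> ab [e e0 fe]; exists e => //; apply: expO_le fe.
by rewrite lerD2r.
Qed.

Lemma expO_small W a b (f : R -> W) : a < b -> expO b f -> small a f.
Proof. by move=> ab fb; exists (b - a); rewrite ?subr_gt0// addrC subrK. Qed.

Lemma small_expO W a (f : R -> W) : small a f -> expO a f.
Proof. by move=> [e e0]; apply: expO_le; rewrite lerDl ltW. Qed.

Lemma small_dom W W' a (f : R -> W) (g : R -> W') (K : R) :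
  (\forall t \near +oo, `|g t| <= K * `|f t|) -> small a f -> small a g.
Proof. by move=> gf [e e0 fe]; exists e => //; exact: expO_dom gf fe. Qed.

Lemma small_eq W a (f g : R -> W) : f =1 g -> small a f -> small a g.
Proof. by move=> /funext ->. Qed.

Lemma small0 W a : small a (fun=> 0 : W).
Proof. by exists 1 => //; exact: expO0. Qed.

Lemma smallD W a (f g : R -> W) :
  small a f -> small a g -> small a (fun t => f t + g t).
Proof.
move=> [e e0 fe] [e' e'0 ge]; exists (Num.min e e').
  by rewrite lt_min e0.
by apply: expOD; [apply: expO_le fe|apply: expO_le ge];
  rewrite lerD2l ge_min lexx ?orbT.
Qed.

Lemma smallN W a (f : R -> W) : small a f -> small a (fun t => - f t).
Proof. by move=> [e e0 fe]; exists e => //; exact: expON. Qed.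

Lemma smallB W a (f g : R -> W) :
  small a f -> small a g -> small a (fun t => f t - g t).
Proof. by move=> fa ga; apply: smallD => //; apply: smallN. Qed.

Lemma small_sum W (I : eqType) (r : seq I) (P : pred I) a (f : I -> R -> W) :
  (forall i, i \in r -> P i -> small a (f i)) ->
  small a (fun t => \sum_(i <- r | P i) f i t).
Proof.
elim: r => [|i r IH] fa.
  by apply: (small_eq _ (small0 W a)) => t; rewrite big_nil.
have IHr : small a (fun t => \sum_(j <- r | P j) f j t).
  by apply: IH => j jr; apply: fa; rewrite in_cons jr orbT.
have [Pi|nPi] := boolP (P i); last first.
  by apply: small_eq IHr => t; rewrite big_cons (negbTE nPi).
have := smallD (fa i (mem_head _ _) Pi) IHr.
by apply: small_eq => t; rewrite big_cons Pi.
Qed.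

Lemma smallZexp W a b (f : R -> W) :
  small b f -> small (a + b) (fun t => expR (- a * t) *: f t).
Proof.
by move=> [e e0 fe]; exists e => //; rewrite -addrA; apply: expOZexp.
Qed.

Lemma expO_lt W (a r : R) (f : R -> W) :
  0 < a -> 0 < r -> expO a f -> \forall t \near +oo, `|f t| < r.
Proof.
move=> a0 r0 [C fC].
have C1 : 0 < `|C| + 1 by rewrite ltr_wpDl.
near=> t.
have t0 : (`|C| + 1) / r / a <= t by near: t; exact: near_pinfty_ge.
apply: (@le_lt_trans _ _ (C * expR (- a * t))); first by near: t.
rewrite mulNr expRN ltr_pdivrMr ?expR_gt0//.
apply: (@lt_le_trans _ _ (r * (1 + a * t))); last first.
  by rewrite ler_wpM2l ?(ltW r0)// expR_ge1Dx.
move: t0; rewrite ler_pdivrMr// ler_pdivrMr// => t0.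
rewrite mulrDr mulr1; have := ler_norm C.
have -> : r * (a * t) = t * a * r by ring.
lra.
Unshelve. all: by end_near. Qed.

End ExpO.

(** * Norms and entries of matrices *)

Section VecO.
Context {R : realType}.

Lemma mx_norm_le_entries m n (M : 'M[R]_(m, n)) (K : R) : 0 <= K ->
  (forall i j, `|M i j| <= K) -> `|M| <= K.
Proof.
move=> K0 MK; rewrite /Num.Def.normr/= mx_normrE bigmax_le// => -[i j] _; exact: MK.
Qed.

Lemma ler_norm_entry m n (M : 'M[R]_(m, n)) i j : `|M i j| <= `|M|.
Proof.
rewrite [leRHS]/Num.Def.normr/= mx_normrE.
exact: (le_bigmax _ (fun ij => `|M ij.1 ij.2|) (i, j)).
Qed.

Lemma ler_norm_mulmx m n p (A : 'M[R]_(m, n)) (B : 'M[R]_(n, p)) :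
  `|A *m B| <= n%:R * `|A| * `|B|.
Proof.
apply: mx_norm_le_entries => [|i j]; first by rewrite !mulr_ge0.
rewrite mxE (le_trans (ler_norm_sum _ _ _))//.
apply: (@le_trans _ _ (\sum_(k < n) `|A| * `|B|)).
  by apply: ler_sum => k _; rewrite normrM ler_pM// ler_norm_entry.
by rewrite sumr_const card_ord -[leLHS]mulr_natl mulrA.
Qed.

Lemma ler_norm_enorm d (v : 'cV[R]_d) : `|v| <= enorm v.
Proof.
apply: mx_norm_le_entries => [|i j]; first exact: sqrtr_ge0.
rewrite ord1 -sqrtr_sqr ler_wsqrtr// (bigD1 i)//= lerDl.
by apply: sumr_ge0 => k _; exact: sqr_ge0.
Qed.

Lemma ler_enorm_norm d (v : 'cV[R]_d) : enorm v <= Num.sqrt d%:R * `|v|.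
Proof.
rewrite /enorm -[X in _ * X]ger0_norm// -sqrtr_sqr -sqrtrM// ler_wsqrtr//.
apply: (@le_trans _ _ (\sum_(k < d) `|v| ^+ 2)).
  apply: ler_sum => k _; rewrite -[leLHS]real_normK ?num_real//.
  by rewrite lerXn2r ?nnegrE// ler_norm_entry.
by rewrite sumr_const card_ord -[leLHS]mulr_natl.
Qed.

Lemma enorm_ge0 d (v : 'cV[R]_d) : 0 <= enorm v.
Proof. exact: sqrtr_ge0. Qed.

Lemma bigO_inftyP d (f : R -> 'cV[R]_d) (a : R) :
  expO a f <-> bigO_infty f (fun t => expR (- a * t)).
Proof.
split=> [[C fC]|[C C0 fC]].
  exists (Num.max 1 (Num.sqrt d%:R * C)); first by rewrite lt_max ltr01.
  near=> t.
  apply: (le_trans (ler_enorm_norm _)).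
  apply: (@le_trans _ _ (Num.sqrt d%:R * C * expR (- a * t))).
    by rewrite -mulrA ler_wpM2l ?sqrtr_ge0//; near: t.
  by rewrite ler_wpM2r ?expR_ge0// le_max lexx orbT.
exists C; near=> t; apply: (le_trans (ler_norm_enorm _)); by near: t.
Unshelve. all: by end_near. Qed.

Lemma expO_mulmx m n p (M : 'M[R]_(m, n)) a (f : R -> 'M[R]_(n, p)) :
  expO a f -> expO a (fun t => M *m f t).
Proof.
apply: (@expO_dom _ _ _ _ _ _ (n%:R * `|M|)); near=> t; exact: ler_norm_mulmx.
Unshelve. all: by end_near. Qed.

Lemma small_mulmx m n p (M : 'M[R]_(m, n)) a (f : R -> 'M[R]_(n, p)) :
  small a f -> small a (fun t => M *m f t).
Proof. by move=> [e e0 fe]; exists e => //; exact: expO_mulmx. Qed.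

Lemma expO_entry m n a (f : R -> 'M[R]_(m, n)) i j :
  expO a f -> expO a (fun t => f t i j).
Proof.
apply: (@expO_dom _ _ _ _ _ _ 1); near=> t; rewrite mul1r; exact: ler_norm_entry.
Unshelve. all: by end_near. Qed.

Lemma small_entry m n a (f : R -> 'M[R]_(m, n)) i j :
  small a f -> small a (fun t => f t i j).
Proof. by move=> [e e0 fe]; exists e => //; exact: expO_entry. Qed.

Lemma col_sum_delta d (v : 'cV[R]_d) : v = \sum_i v i ord0 *: delta_mx i ord0.
Proof.
by rewrite {1}[v]matrix_sum_delta; apply: eq_bigr => i _; rewrite big_ord1.
Qed.

Lemma expO_entries d a (f : R -> 'cV[R]_d) :
  (forall i, expO a (fun t => f t i ord0)) -> expO a f.
Proof.
move=> fa.
apply: (@expO_eq _ _ _ (fun t => \sum_(i < d) f t i ord0 *: delta_mx i ord0)).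
  by move=> t; rewrite -col_sum_delta.
apply: expO_sum => i _ _; rewrite -[a]addr0; apply: expOM (fa i) (expO_cst _).
Qed.

Lemma small_entries d a (f : R -> 'cV[R]_d) :
  (forall i, small a (fun t => f t i ord0)) -> small a f.
Proof.
move=> fa.
apply: (@small_eq _ _ _ (fun t => \sum_(i < d) f t i ord0 *: delta_mx i ord0)).
  by move=> t; rewrite -col_sum_delta.
apply: small_sum => i _ _; have [e e0 fe] := fa i; exists e => //.
rewrite -[a + e]addr0; apply: expOM fe (expO_cst _).
Qed.

Lemma entryD d (v w : 'cV[R]_d) i : (v + w) i ord0 = v i ord0 + w i ord0.
Proof. by rewrite mxE. Qed.

Lemma entryZ d (v : 'cV[R]_d) (c : R) i : (c *: v) i ord0 = c * v i ord0.
Proof. by rewrite mxE. Qed.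

Lemma entryB d (v w : 'cV[R]_d) (c : R) i :
  (v - c *: w) i ord0 = v i ord0 - c * w i ord0.
Proof. by rewrite !mxE. Qed.

End VecO.

(** * Scalar linear differential equations *)

Section ScalarODE.
Context {R : realType}.
Implicit Types (g dg u f : R -> R) (p q : {poly R}).

(** The mean value theorem, in the form that replaces integration below. *)
Lemma is_derive_le0_nincr g dg (a b : R) : a <= b ->
  (forall x, a <= x <= b -> is_derive x 1 g (dg x)) ->
  (forall x, a <= x <= b -> dg x <= 0) -> g b <= g a.
Proof.
move=> ab dgP dg0.
have gc : {within `[a, b], continuous g}.
  apply: derivable_within_continuous => x; rewrite in_itv/= => xab.
  by have [] := dgP _ xab.
have dgP' x : x \in `]a, b[ -> is_derive x 1 g (dg x).
  by rewrite in_itv/= => /andP[ax xb]; apply: dgP; rewrite !ltW.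
have [c] := @MVT_segment _ g dg a b ab dgP' gc.
rewrite in_itv/= => cab gE.
by rewrite -subr_le0 gE mulr_le0_ge0// ?dg0// subr_ge0.
Qed.

Lemma is_derive_prod g u (t dg du : R) : is_derive t 1 g dg ->
  is_derive t 1 u du ->
  is_derive t 1 (fun s => g s * u s) (dg * u t + g t * du).
Proof.
move=> dg_ du_; have h := is_deriveM dg_ du_.
by apply: (is_derive_eq h); rewrite /GRing.scale/=; ring.
Qed.

Lemma is_derive_cstM g (c t dg : R) : is_derive t 1 g dg ->
  is_derive t 1 (fun s => c * g s) (c * dg).
Proof. by move=> dg_; have := is_deriveZ c dg_. Qed.

Lemma is_derive_expRM (k t : R) :
  is_derive t 1 (fun s : R => expR (k * s)) (k * expR (k * t)).
Proof.
have dk : is_derive t 1 (fun s : R => k * s) k.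
  by have := is_derive_cstM k (is_derive_id t 1); rewrite mulr1.
have := is_derive1_comp (is_derive_expR (k * t)) dk.
by rewrite mulrC.
Qed.

(** Both [g] and [- g] minus C/k e^{kt}, a primitive of the bound for the
    derivative, are nonincreasing. *)
Lemma growth_bound_pos g dg (T C k : R) : 0 < k ->
  (forall t, T < t -> is_derive t 1 g (dg t)) ->
  (forall t, T < t -> `|dg t| <= C * expR (k * t)) ->
  exists M : R, forall t, T + 1 <= t -> `|g t| <= M + C / k * expR (k * t).
Proof.
move=> k0 dgP dgC.
exists (`|g (T + 1)| ) => t Tt.
have T1 : T < T + 1 by rewrite ltrDl.
have C0 : 0 <= C.
  by have := le_trans (normr_ge0 _) (dgC _ T1); rewrite pmulr_lge0// expR_gt0.
have gt (x : R) : T + 1 <= x <= t -> T < x by move=> /andP[/(lt_le_trans T1)].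
have dE (x : R) : is_derive x 1 (fun t => C / k * expR (k * t)) (C * expR (k * x)).
  apply: (is_derive_eq (is_derive_cstM _ (is_derive_expRM k x))).
  by field; exact: lt0r_neq0.
have h1 : g t - C / k * expR (k * t) <= g (T + 1) - C / k * expR (k * (T + 1)).
  apply: (@is_derive_le0_nincr (fun t => g t - C / k * expR (k * t))
    (fun t => dg t - C * expR (k * t)) _ _ Tt) => x /gt Tx.
    have ? := dgP x Tx; have ? := dE x; exact: is_deriveB.
  by rewrite subr_le0 (le_trans (ler_norm _))// dgC.
have h2 : - g t - C / k * expR (k * t)
    <= - g (T + 1) - C / k * expR (k * (T + 1)).
  apply: (@is_derive_le0_nincr (fun t => - g t - C / k * expR (k * t))
    (fun t => - dg t - C * expR (k * t)) _ _ Tt) => x /gt Tx.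
    have ? := dgP x Tx; have ? := dE x; apply: is_deriveB.
  by rewrite subr_le0 (le_trans (ler_norm _))// normrN dgC.
have E0 : 0 <= C / k * expR (k * (T + 1)).
  by rewrite !mulr_ge0 ?expR_ge0// invr_ge0 ltW.
have := ler_norm (g (T + 1)); have := ler_norm (- g (T + 1)); rewrite normrN.
move=> ? ?; rewrite ler_norml; apply/andP; split; lra.
Qed.

(** As [k] is negative, g - E is nondecreasing and g + E is nonincreasing for
    E = C/(-k) e^{kt}, which tends to 0. Every value of the first is below
    every value of the second, and the supremum of the first is the limit of
    [g]. *)
Lemma growth_bound_neg g dg (T C k : R) : k < 0 ->
  (forall t, T < t -> is_derive t 1 g (dg t)) ->
  (forall t, T < t -> `|dg t| <= C * expR (k * t)) ->
  exists c : R, forall t, T < t -> `|g t - c| <= C / - k * expR (k * t).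
Proof.
move=> k0 dgP dgC.
pose E t := C / - k * expR (k * t).
have C0 : 0 <= C.
  have T1 : T < T + 1 by rewrite ltrDl.
  by have := le_trans (normr_ge0 _) (dgC _ T1); rewrite pmulr_lge0// expR_gt0.
have E0 t : 0 <= E t.
  by rewrite !mulr_ge0 ?expR_ge0// invr_ge0 oppr_ge0 ltW.
have dE (x : R) : is_derive x 1 E (- C * expR (k * x)).
  apply: (is_derive_eq (is_derive_cstM _ (is_derive_expRM k x))).
  by field; exact: ltr0_neq0.
have up s t : T < s -> s <= t -> g t + E t <= g s + E s.
  move=> Ts st.
  apply: (@is_derive_le0_nincr (fun t => g t + E t)
    (fun t => dg t + - C * expR (k * t)) _ _ st) => x /andP[sx _];
    have Tx := lt_le_trans Ts sx.
    have ? := dgP x Tx; have ? := dE x; exact: is_deriveD.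
  by rewrite mulNr subr_le0 (le_trans (ler_norm _))// dgC.
have lo s t : T < s -> s <= t -> g s - E s <= g t - E t.
  move=> Ts st; rewrite -lerN2 !opprB.
  apply: (@is_derive_le0_nincr (fun t => E t - g t)
    (fun t => - C * expR (k * t) - dg t) _ _ st) => x /andP[sx _];
    have Tx := lt_le_trans Ts sx.
    have ? := dgP x Tx; have ? := dE x; exact: is_deriveB.
  have := dgC _ Tx; have := ler_norm (- dg x); rewrite normrN; lra.
have lu s t : T < s -> T < t -> g s - E s <= g t + E t.
  move=> Ts Tt; have [st|/ltW ts] := leP s t.
    by have := lo _ _ Ts st; have := E0 t; lra.
  by have := up _ _ Tt ts; have := E0 s; lra.
pose A := [set g s - E s | s in [set s | T < s]].
have A0 : A !=set0.
  by exists (g (T + 1) - E (T + 1)); exists (T + 1) => //=; rewrite ltrDl.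
exists (sup A) => t Tt.
have l1 : g t - E t <= sup A.
  apply: ub_le_sup; last by exists t.
  by exists (g t + E t) => _ [s Ts <-]; exact: lu.
have l2 : sup A <= g t + E t.
  by apply: ge_sup => // _ [s Ts <-]; exact: lu.
by rewrite ler_norml -/(E t); apply/andP; split; lra.
Qed.

Lemma near_pinfty_ex (P : R -> Prop) : (\forall t \near +oo, P t) ->
  exists2 T : R, 0 <= T & forall t, T < t -> P t.
Proof.
move=> [T [_ TP]]; exists (Num.max 0 T); first by rewrite le_max lexx.
by move=> t; rewrite gt_max => /andP[_]; exact: TP.
Qed.

(** Variation of constants: g = e^{dt} u has derivative e^{dt} f. If d < rho,
    this derivative is integrable at infinity and c is the limit of [g];
    otherwise the bound for the growth of [g] gives the claim with c = 0. A
    mode c e^{-dt} with d >= rho' is itself O(e^{-rho' t}) and is dropped,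
    which gives the last clause: a nonzero coefficient belongs to a mode that
    dominates the error. *)
Lemma scalar_ode_decay u f (d rho rho' : R) :
  (forall t : R, 0 < t -> is_derive t 1 u (f t - d * u t)) ->
  expO rho f -> rho' < rho ->
  exists c : R, expO rho' (fun t => u t - c * expR (- d * t)) /\
    (c != 0 -> d < rho').
Proof.
move=> du frho rho'rho.
pose g t := expR (d * t) * u t.
have dgP (t : R) : 0 < t -> is_derive t 1 g (expR (d * t) * f t).
  move=> t0; apply: (is_derive_eq (is_derive_prod (is_derive_expRM d t) (du t t0))).
  ring.
have uE t : u t = expR (- d * t) * g t.
  by rewrite /g mulrA -expRD mulNr addNr expR0 mul1r.
have bnd rho1 : expO rho1 f -> exists C T : R, 0 <= T /\ forall t, T < t ->
    `|expR (d * t) * f t| <= C * expR ((d - rho1) * t).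
  move=> [C /near_pinfty_ex[T T0 fC]]; exists C, T; split=> // t Tt.
  rewrite normrM (ger0_norm (expR_ge0 _)) mulrDl expRD mulrCA.
  by rewrite ler_wpM2l ?expR_ge0// fC.
have [drho|rhod] := ltP d rho.
  have [C [T [T0 fC]]] := bnd _ frho.
  have k0 : d - rho < 0 by rewrite subr_lt0.
  have [c gc] := growth_bound_neg k0
    (fun t Tt => dgP t (le_lt_trans T0 Tt)) fC.
  have uc : expO rho (fun t => u t - c * expR (- d * t)).
    exists (C / - (d - rho)); near=> t.
    have -> : u t - c * expR (- d * t) = expR (- d * t) * (g t - c).
      by rewrite uE; ring.
    rewrite normrM (ger0_norm (expR_ge0 _)).
    have -> : - rho * t = - d * t + (d - rho) * t by ring.
    rewrite expRD mulrCA ler_wpM2l ?expR_ge0//.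
    by apply: gc; near: t; apply: nbhs_pinfty_gt; exact: num_real.
  have [dr|rd] := ltP d rho'.
    by exists c; split=> //; apply: expO_le uc; exact: ltW.
  exists 0; rewrite eqxx; split=> //.
  apply: (@expO_eq _ _ _
    (fun t => (u t - c * expR (- d * t)) + expR (- d * t) *: c)).
    by move=> t; rewrite /GRing.scale/=; ring.
  apply: expOD; first by apply: expO_le uc; exact: ltW.
  by have := expOZexp d (expO_cst (c : R^o)); rewrite addr0; exact: expO_le.
have [C [T [T0 fC]]] := bnd _ (expO_le (ltW rho'rho) frho).
have k0 : 0 < d - rho' by rewrite subr_gt0 (lt_le_trans rho'rho).
have [M gM] := growth_bound_pos k0
    (fun t Tt => dgP t (le_lt_trans T0 Tt)) fC.
exists 0; rewrite eqxx; split=> //.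
exists (`|M| + C / (d - rho')); near=> t.
rewrite mul0r subr0 uE normrM (ger0_norm (expR_ge0 _)).
apply: (@le_trans _ _
  (expR (- d * t) * (M + C / (d - rho') * expR ((d - rho') * t)))).
  by rewrite ler_wpM2l ?expR_ge0// gM//.
have -> : - d * t = - rho' * t + - (d - rho') * t by ring.
rewrite expRD -mulrA mulrC ler_wpM2r ?expR_ge0//.
rewrite mulrDr mulrCA -expRD -mulrDl addNr mul0r expR0 mulr1 lerD2r.
rewrite (le_trans (ler_norm _))// normrM ler_piMl//.
rewrite ger0_norm ?expR_ge0// -expR0 ler_expR mulNr oppr_le0 mulr_ge0//.
exact: ltW.
Unshelve. all: by end_near. Qed.

(** For a = 0 take a primitive. Otherwise q = a^-1 (p - q') is solved by
    induction on the degree, which differentiation lowers. *)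
Lemma poly_ode_solvable (a : R) p : exists q, q^`() + a *: q = p.
Proof.
have [->|a0] := eqVneq a 0.
  exists (\poly_(i < (size p).+1) (p`_i.-1 / i%:R)).
  rewrite scale0r addr0; apply/polyP => i; rewrite coef_deriv coef_poly ltnS.
  have [ip|ip] := ltnP i (size p); last by rewrite mul0rn nth_default.
  by rewrite /= -[_ *+ _]mulr_natr divfK// pnatr_eq0.
have [n] := ubnP (size p); elim: n p => // n IH p.
rewrite ltnS => pn.
have [p0|p0] := eqVneq p 0.
  by exists 0; rewrite p0 deriv0 scaler0 addr0.
have sz : (size p^`()%R < n)%N.
  by apply: leq_trans pn; exact: lt_size_deriv.
have [q qE] := IH (- a^-1 *: p^`()) (leq_ltn_trans (size_scale_leq _ _) sz).
exists (q + a^-1 *: p).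
rewrite derivD derivZ scalerDr scalerA divff// scale1r addrACA qE.
by rewrite scaleNr addrA addNr add0r.
Qed.

(** After a polynomial solution is subtracted, what remains is c e^{-at} up to
    an exponentially small error. This mode is itself small if a > 0, a
    constant that can be added to the polynomial if a = 0, and excluded by the
    last hypothesis if a < 0. *)
Lemma scalar_ode_expansion (z r : R -> R) (a : R) p :
  (forall t : R, 0 < t -> is_derive t 1 z (p.[t] + r t - a * z t)) ->
  small 0 r ->
  (a < 0 -> small 0 (fun t => expR (a * t) * z t)) ->
  exists q, q^`() + a *: q = p /\ small 0 (fun t => z t - q.[t]).
Proof.
move=> dz [e e0]; rewrite add0r => re za.
have [q0 q0E] := poly_ode_solvable a p.
pose v t := z t - q0.[t].
have dv (t : R) : 0 < t -> is_derive t 1 v (r t - a * v t).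
  move=> t0.
  apply: (is_derive_eq (is_deriveB (dz t t0) (is_derive_poly q0 t))).
  have := congr1 (fun q => q.[t]) q0E; rewrite !hornerE => E. rewrite -E /v; ring.
have e2 : e / 2 < e by lra.
have [c [vc ca]] := scalar_ode_decay dv re e2.
have e20 : 0 < e / 2 by lra.
have vs : small 0 (fun t => v t - c * expR (- a * t)).
  by apply: expO_small vc.
have [a0|a0|a0] := ltgtP a 0; last first.
- exists (q0 + c%:P); split.
    by rewrite -q0E derivD derivC addr0 a0 !scale0r.
  apply: small_eq vs => t; rewrite /v !hornerE a0 oppr0 mul0r expR0; ring.
- exists q0; split=> //.
  apply: (@small_eq _ _ _
    (fun t => (v t - c * expR (- a * t)) + expR (- a * t) *: c)).
    by move=> t; rewrite /v /GRing.scale/=; ring.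
  apply: smallD vs _; have := expOZexp a (expO_cst (c : R^o)); rewrite addr0.
  exact: expO_small.
- exists q0; split=> //.
  suff c0 : c = 0.
    by apply: small_eq vs => t; rewrite c0 mul0r subr0.
  (* c = e^{at} z - e^{at} q0 - e^{at} (v - c e^{-at}), and each term decays. *)
  have cs : small 0 (fun=> c).
    have h1 : small 0 (fun t => expR (a * t) * q0.[t]).
      apply: (@expO_small _ _ _ (- a + - (- a / 2))); first lra.
      have := @expO_poly _ (- a / 2) q0.
      have -> : (fun t => expR (a * t) * q0.[t])
          = (fun t => expR (- - a * t) *: q0.[t]).
        by apply/funext => t; rewrite opprK.
      by move=> h; apply/expOZexp/h; lra.
    have h2 : small 0 (fun t => expR (a * t) * (v t - c * expR (- a * t))).
      apply: (@small_le _ _ _ (- a + 0)); first lra.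
      have -> : (fun t => expR (a * t) * (v t - c * expR (- a * t)))
          = (fun t => expR (- - a * t) *: (v t - c * expR (- a * t))).
        by apply/funext => t; rewrite opprK.
      exact: smallZexp.
    have := smallB (smallB (za a0) h1) h2.
    apply: small_eq => t; rewrite /v.
    have : expR (a * t) * expR (- a * t) = 1 by rewrite -expRD -mulrDl subrr mul0r expR0.
    by move=> E; ring: E.
  apply/eqP/negP => /negP c0; move: cs => [e' e'0 [C cC]].
  have := @near_pinfty_ge R (C / (`|c| * e')) => cT.
  have [T T0 TP] := near_pinfty_ex (filterI cC cT).
  have [] := TP (T + 1); first by rewrite ltrDl.
  have t0 : 0 < T + 1 by lra.
  rewrite add0r mulNr expRN ler_pdivlMr ?expR_gt0// => h1 h2.
  have : `|c| * (1 + e' * (T + 1)) <= C.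
    by apply: le_trans h1; rewrite ler_wpM2l// expR_ge1Dx.
  have c0' : 0 < `|c| by rewrite normr_gt0.
  move: h2; rewrite ler_pdivrMr ?mulr_gt0// => h2.
  rewrite mulrDr mulr1 mulrA => h3; lra.
Qed.

End ScalarODE.

(** * Superlinearity of the nonlinear term *)

Section Homogeneous.
Context {R : realType} {d : nat}.
Local Notation U := 'cV[R]_d.
Implicit Types (G H : nat -> U -> U) (F : U -> U) (beta : nat -> R).

Lemma homogeneous0 (b : R) (G : U -> U) : 0 < b -> homogeneous b G -> G 0 = 0.
Proof.
move=> b0 hG; have := hG 0 2 (ltr0Sn _ _); rewrite scaler0 => GE.
have h1 : 2 `^ b != 1 :> R.
  by rewrite powR_eq1 !negb_or (gt_eqF b0) gt_eqF ?ltr1n// -leNgt ler0n.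
have : (2 `^ b - 1) *: G 0 == 0 by rewrite scalerBl scale1r -GE subrr.
by rewrite scaler_eq0 subr_eq0 (negbTE h1) => /eqP.
Qed.

(** If S is the sum of the G_k, then 2^{beta_{n+1}} S(x/2) - S(x) no longer
    contains G_{n+1} and contains every other G_k with a nonzero factor, so
    the induction hypothesis applies. A compactness argument on the sphere is
    not available, since away from the eigenvectors the G_k need not be
    continuous. *)
Lemma homogeneous_sum_bounded n beta G (r C : R) :
  (forall j k, (0 < j)%N -> (j < k)%N -> (k <= n)%N -> beta j < beta k) ->
  (forall k, (0 < k <= n)%N -> homogeneous (beta k) (G k)) ->
  (forall x, `|x| < r -> `|\sum_(1 <= k < n.+1) G k x| <= C) ->
  forall k, (0 < k <= n)%N ->
    exists C', forall x, `|x| < r -> `|G k x| <= C'.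
Proof.
elim: n G C => [|n IH] G C bm hG SC k; first by case: k.
pose S x := \sum_(1 <= k < n.+2) G k x.
have SE x : S x = \sum_(1 <= k < n.+1) G k x + G n.+1 x by rewrite /S big_nat_recr.
pose c k : R := 2 `^ beta n.+1 * 2^-1 `^ beta k.
have half0 : 0 < 2^-1 :> R by rewrite invr_gt0.
have cE j : c j = 2 `^ (beta n.+1 - beta j).
  have -> : c j = 2 `^ (beta n.+1 - beta j + beta j) * 2^-1 `^ beta j.
    by rewrite subrK.
  rewrite powRD ?pnatr_eq0 ?implybT//.
  rewrite -mulrA -powRM ?invr_ge0 ?ler0n// divff ?pnatr_eq0// powR1.
  by rewrite mulr1.
have low j : (0 < j <= n)%N -> exists C', forall x, `|x| < r -> `|G j x| <= C'.
  move=> jn.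
  pose H k x := (c k - 1) *: G k x.
  have hH i : (0 < i <= n)%N -> homogeneous (beta i) (H i).
    move=> /andP[i0 iN] x t t0; rewrite /H hG ?i0 ?leqW//.
    by rewrite !scalerA mulrC.
  have bH : forall x, `|x| < r ->
      `|\sum_(1 <= k < n.+1) H k x| <= 2 `^ beta n.+1 * C + C.
    move=> x xr.
    have -> : \sum_(1 <= k < n.+1) H k x
        = 2 `^ beta n.+1 *: S (2^-1 *: x) - S x.
      rewrite !SE hG ?leqnn//  scalerDr scalerA -/(c n.+1) cE subrr powRr0 scale1r.
      rewrite opprD addrACA subrr addr0 scaler_sumr -sumrB.
      apply: eq_big_nat => i /andP[i0 iN].
      have iN' : (0 < i <= n.+1)%N by rewrite i0 (ltnW iN).
      by rewrite (hG _ iN')// scalerA -/(c i) /H scalerBl scale1r.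
    rewrite (le_trans (ler_normB _ _))// lerD ?SC//.
    rewrite normrZ ger0_norm ?powR_ge0// ler_wpM2l ?powR_ge0// SC//.
    rewrite normrZ ger0_norm ?(ltW half0)//.
    by apply: le_lt_trans xr; rewrite ler_piMl// invf_le1// ler1n.
  have bm' i l : (0 < i)%N -> (i < l)%N -> (l <= n)%N -> beta i < beta l.
    by move=> i0 il ln; apply: bm => //; exact: leqW.
  have [C' HC'] := IH H _ bm' hH bH _ jn.
  have c1 : 0 < c j - 1.
    case/andP: jn => j0 jn.
    rewrite subr_gt0 cE lt_def powR_eq1 !negb_or subr_eq0 [beta _ == _]gt_eqF ?bm//.
    rewrite gt_eqF ?ltr1n//= -leNgt ler0n/=.
    apply: (@le_trans _ _ (2 `^ 0)); first by rewrite powRr0.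
    by rewrite ler_powR ?ler1n// subr_ge0 ltW// bm.
  exists ((c j - 1)^-1 * C') => x xr.
  rewrite ler_pdivlMl//; apply: le_trans (HC' x xr).
  by rewrite /H normrZ gtr0_norm.
case/andP=> k0; rewrite leq_eqVlt ltnS => /orP[/eqP ->|kn]; last first.
  by apply: low; rewrite k0.
suff [C' PC'] : exists C' : R, forall x, `|x| < r -> `|\sum_(1 <= k < n.+1) G k x| <= C'.
  exists (C + C') => x xr.
  have := SC x xr; rewrite big_nat_recr//= => h.
  rewrite -[G n.+1 x](addKr (\sum_(1 <= k < n.+1) G k x)) addrC.
  by rewrite (le_trans (ler_normB _ _))// lerD ?PC'.
have : forall m, (m <= n)%N -> exists C' : R, forall x, `|x| < r ->
    `|\sum_(1 <= k < m.+1) G k x| <= C'.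
  elim=> [_|m IHm mn].
    by exists 0 => x _; rewrite big_geq// normr0.
  have [C1 h1] := IHm (ltnW mn).
  have [C2 h2] := low m.+1 mn.
  exists (C1 + C2) => x xr; rewrite big_nat_recr//=.
  by rewrite (le_trans (ler_normD _ _))// lerD ?h1 ?h2.
exact.
Qed.

Lemma homogeneous_bound (b : R) (G : U -> U) (r C : R) : 0 < b -> 0 < r ->
  homogeneous b G -> (forall x, `|x| < r -> `|G x| <= C) ->
  exists C', forall x, `|G x| <= C' * `|x| `^ b.
Proof.
move=> b0 r0 hG GC; exists ((2 / r) `^ b * C) => x.
have [->|x0] := eqVneq x 0.
  by rewrite (homogeneous0 b0)// !normr0 powR0 ?mulr0// gt_eqF.
have xp : 0 < `|x| by rewrite normr_gt0.
pose t := 2 / r * `|x|.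
have t0 : 0 < t by rewrite !mulr_gt0 ?invr_gt0.
have -> : G x = t `^ b *: G (t^-1 *: x).
  by rewrite -hG// scalerA divff ?scale1r// gt_eqF.
have tE : t `^ b = (2 / r) `^ b * `|x| `^ b by rewrite powRM// ltW// divr_gt0.
rewrite normrZ ger0_norm ?powR_ge0// tE mulrAC.
rewrite ler_wpM2r ?powR_ge0// ler_wpM2l ?powR_ge0// GC//.
rewrite normrZ gtr0_norm ?invr_gt0// invfM -mulrA mulVf ?gt_eqF// mulr1.
by rewrite invfM invrK mulrC ltr_pdivrMr ?ltr0n// ltr_pMr// ltr1n.
Qed.

Lemma remainder_bound_norm F G M (b : R) : 0 <= b -> remainder_bound F G M b ->
  exists r C : R, [/\ 0 < r, 0 < C & forall x, `|x| < r ->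
    `|F x - \sum_(1 <= k < M.+1) G k x| <= C * `|x| `^ b].
Proof.
move=> b0 [r [C [r0 C0 FC]]].
pose K : R := Num.sqrt d%:R + 1.
have K0 : 0 < K by rewrite ltr_wpDl ?sqrtr_ge0.
have enK (x : U) : enorm x <= K * `|x|.
  by apply: (le_trans (ler_enorm_norm _)); rewrite ler_wpM2r// lerDl.
exists (r / K), (C * K `^ b); split=> [||x xr].
- exact: divr_gt0.
- by rewrite mulr_gt0// powR_gt0.
- apply: (le_trans (ler_norm_enorm _)).
  apply: (le_trans (FC x _)).
    by apply: (le_lt_trans (enK x)); rewrite mulrC -ltr_pdivlMr.
  rewrite -mulrA -powRM ?(ltW K0)// ler_wpM2l ?(ltW C0)//.
  by apply: ge0_ler_powR; rewrite ?nnegrE ?enorm_ge0 ?mulr_ge0 ?(ltW K0).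
Qed.

Definition superlinear (F : U -> U) (b : R) : Prop :=
  exists r C : R, [/\ 0 < r, 0 < C & forall x, `|x| < r -> `|F x| <= C * `|x| `^ b].

(** Near 0 the function F is bounded, hence so is the sum of the G_k, hence so
    is each of them; by homogeneity G_k = O(|x|^{beta_k}), and beta_1 is the
    smallest of the exponents. *)
Lemma superlinear_bound F beta G M (b : R) : (0 < M)%N -> 0 < beta 1%N ->
  (forall j k, (0 < j)%N -> (j < k)%N -> (k <= M)%N -> beta j < beta k) ->
  (forall k, (0 < k <= M)%N -> homogeneous (beta k) (G k)) ->
  beta 1%N <= b -> remainder_bound F G M b -> {for 0, continuous F} ->
  superlinear F (beta 1%N).
Proof.
move=> M0 b10 bm hG bb /(remainder_bound_norm (le_trans (ltW b10) bb)).
move=> [r [C [r0 C0 FC]]] cF.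
have [r1 r10 Fr1] : exists2 r1 : R, 0 < r1 & forall x, `|x| < r1 -> `|F x| <= `|F 0| + 1.
  have /cvgrPdist_lt/(_ 1 ltr01)/nbhs_ballP[e /= e0 eF] := cF.
  exists e => // x xe.
  have := eF x; rewrite -ball_normE/= sub0r normrN => /(_ xe) h.
  rewrite -[F x](subKr (F 0)) (le_trans (ler_normB _ _))// lerD2l ltW//.
pose s := Num.min 1 (Num.min r r1).
have s0 : 0 < s by rewrite !lt_min ltr01 r0.
have le1 (c x : R) : 0 < c -> beta 1%N <= c -> 0 <= x < 1 -> x `^ c <= x `^ beta 1%N.
  move=> c0 cb /andP[]; rewrite le_eqVlt => /orP[/eqP <- _|x0 x1].
    by rewrite !powR0// gt_eqF.
  by rewrite ger_powR// x0 ltW.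
have [C2 SC2] : exists C2 : R, forall x, `|x| < s -> `|\sum_(1 <= k < M.+1) G k x| <= C2.
  exists ((`|F 0| + 1) + C) => x; rewrite !lt_min => /and3P[x1 xr xr1].
  rewrite -[X in `|X|](subKr (F x)) (le_trans (ler_normB _ _))// lerD ?Fr1//.
  apply: (le_trans (FC _ xr)); rewrite ler_piMr ?(ltW C0)//.
  apply: (@le_trans _ _ (1 `^ b)); last by rewrite powR1.
  by apply: ge0_ler_powR; rewrite ?nnegrE ?(ltW x1)// (le_trans _ bb)// ltW.
have each := homogeneous_sum_bounded bm hG SC2.
have sumB : forall m, (m <= M)%N -> exists2 C' : R, 0 <= C' & forall x, `|x| < s ->
    `|\sum_(1 <= k < m.+1) G k x| <= C' * `|x| `^ beta 1%N.
  elim=> [_|m IHm mn].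
    by exists 0 => // x _; rewrite big_geq// normr0 mul0r.
  have [C3 C30 h3] := IHm (ltnW mn).
  have [C4 h4] := each m.+1 mn.
  have bb1 : beta 1%N <= beta m.+1.
    by case: m mn {IHm h3 h4} => // m mn; rewrite ltW// bm.
  have bm0 : 0 < beta m.+1 by apply: lt_le_trans bb1.
  have [C5 h5] := homogeneous_bound bm0 s0 (hG m.+1 mn) h4.
  exists (C3 + `|C5|); first by rewrite addr_ge0.
  move=> x xs; rewrite big_nat_recr//= (le_trans (ler_normD _ _))// mulrDl lerD ?h3//.
  apply: (le_trans (h5 x)).
  apply: (@le_trans _ _ (`|C5| * `|x| `^ beta m.+1)).
    by rewrite ler_wpM2r ?powR_ge0// ler_norm.
  rewrite ler_wpM2l// le1//= normr_ge0/=.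
  by move: xs; rewrite !lt_min => /and3P[].
have [C6 C60 h6] := sumB M (leqnn _).
exists s, (C6 + C); split=> //; first by rewrite ltr_wpDl.
move=> x xs.
rewrite -[F x](subrK (\sum_(1 <= k < M.+1) G k x)) addrC.
rewrite (le_trans (ler_normD _ _))// mulrDl lerD ?h6//.
move: (xs); rewrite !lt_min => /and3P[x1 xr _].
apply: (le_trans (FC _ xr)); rewrite ler_wpM2l ?(ltW C0)// le1 ?normr_ge0//.
exact: lt_le_trans bb.
Qed.

Lemma locally_lipschitz_continuous F : locally_lipschitz F -> continuous F.
Proof.
move=> lF x; have [W xW [k [_ kP]]] := lF x.
have lW : forall z, W z -> `|F x - F z| <= (`|k| + 1) * `|x - z|.
  move=> z Wz; apply: (kP (`|k| + 1) _ (x, z)).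
    by rewrite (le_lt_trans (ler_norm _))// ltrDl.
  by split=> //=; exact: nbhs_singleton.
apply/(@cvgrPdist_le R U U (nbhs x) _ F (F x)) => e e0.
have k0 : 0 < `|k| + 1 by rewrite ltr_wpDl.
have /nbhs_ballP[r /= r0 rW] := xW.
apply/nbhs_ballP; exists (Num.min r (e / (`|k| + 1))).
  by rewrite /= lt_min r0 divr_gt0.
move=> z; rewrite -ball_normE/= lt_min => /andP[zr ze].
have Wz : W z by apply: rW; rewrite -ball_normE.
by rewrite (le_trans (lW z Wz))// mulrC -ler_pdivlMr// ltW.
Qed.

End Homogeneous.

(** * The leading term in diagonal coordinates *)

Section Diagonal.
Context {R : realType} {d : nat}.
Local Notation U := 'cV[R]_d.
Implicit Types (u f y : R -> U) (D : 'I_d -> R).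

Lemma is_derive_entry (m n : nat) (y : R -> 'M[R]_(m, n)) (t : R) dy i j :
  is_derive t 1 y dy -> is_derive t 1 (fun s => y s i j) (dy i j).
Proof.
move=> [yd <-]; rewrite derive_mx//.
have h := derivableP ((derivable_mxP _ _ _).1 yd i j).
by apply: (is_derive_eq h); rewrite mxE.
Qed.

Lemma is_derive_big (I : eqType) (r : seq I) (g : I -> R -> R) (dg : I -> R) (t : R) :
  (forall i, i \in r -> is_derive t 1 (g i) (dg i)) ->
  is_derive t 1 (fun s => \sum_(i <- r) g i s) (\sum_(i <- r) dg i).
Proof.
elim: r => [_|i r IH gd].
  have -> : (fun s => \sum_(i <- [::]) g i s) = cst 0.
    by apply/funext => s; rewrite big_nil.
  by rewrite big_nil; exact: is_derive_cst.
have -> : (fun s => \sum_(j <- i :: r) g j s) = (fun s => g i s + \sum_(j <- r) g j s).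
  by apply/funext => s; rewrite big_cons.
rewrite big_cons; apply: is_deriveD; first by apply: gd; rewrite mem_head.
by apply: IH => j jr; apply: gd; rewrite in_cons jr orbT.
Qed.

Lemma is_derive_mulmx_entry m (M : 'M[R]_(m, d)) y (t : R) (dy : U) i :
  is_derive t 1 y dy ->
  is_derive t 1 (fun s => (M *m y s) i ord0) ((M *m dy) i ord0).
Proof.
move=> yd.
have -> : (fun s => (M *m y s) i ord0) = (fun s => \sum_(k < d) M i k * y s k ord0).
  by apply/funext => s; rewrite mxE.
rewrite mxE; apply: is_derive_big => k _.
by apply: is_derive_cstM; exact: is_derive_entry.
Qed.

(** The square of the Euclidean norm: unlike the sup norm it is differentiable
    along solutions. *)
Definition energy (v : U) : R := \sum_(i < d) v i ord0 ^+ 2.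

Lemma energy_ge0 v : 0 <= energy v.
Proof. by apply: sumr_ge0 => i _; exact: sqr_ge0. Qed.

Lemma energyE v : energy v = enorm v ^+ 2.
Proof. by rewrite sqr_sqrtr// energy_ge0. Qed.

Lemma norm_energy v : `|v| ^+ 2 <= energy v.
Proof. by rewrite energyE lerXn2r ?nnegrE ?enorm_ge0// ler_norm_enorm. Qed.

Lemma energy_norm v : energy v <= d%:R * `|v| ^+ 2.
Proof.
have -> : d%:R * `|v| ^+ 2 = (Num.sqrt d%:R * `|v|) ^+ 2.
  by rewrite exprMn sqr_sqrtr.
by rewrite energyE lerXn2r ?nnegrE ?enorm_ge0 ?mulr_ge0 ?sqrtr_ge0// ler_enorm_norm.
Qed.

Lemma energy_gt0 v : v != 0 -> 0 < energy v.
Proof.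
by move=> v0; apply: lt_le_trans (norm_energy v); rewrite exprn_gt0// normr_gt0.
Qed.

Lemma energy_derive u f D (t : R) :
  (forall i, is_derive t 1 (fun s => u s i ord0) (f t i ord0 - D i * u t i ord0)) ->
  is_derive t 1 (fun s => energy (u s))
    (\sum_(i < d) 2 * u t i ord0 * (f t i ord0 - D i * u t i ord0)).
Proof.
move=> ud; apply: is_derive_big => i _.
apply: (is_derive_eq (is_derive_prod (ud i) (ud i))); ring.
Qed.

Lemma inner_bound (v w : U) (L : R) : 0 <= L -> `|w| <= L * `|v| ->
  `|\sum_(i < d) v i ord0 * w i ord0| <= d%:R * L * energy v.
Proof.
move=> L0 wv; apply: (le_trans (ler_norm_sum _ _ _)).
apply: (@le_trans _ _ (\sum_(i < d) L * energy v)); last first.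
  by rewrite sumr_const card_ord -[leLHS]mulr_natl mulrA.
apply: ler_sum => i _; rewrite normrM.
apply: (@le_trans _ _ (`|v| * (L * `|v|))).
  by rewrite ler_pM// ?ler_norm_entry// (le_trans (ler_norm_entry _ _ _)).
by rewrite mulrCA -expr2 ler_wpM2l// norm_energy.
Qed.

(** The bound on [f] gives energy' >= - K energy, so e^{Kt} energy is
    nondecreasing. The constants do not depend on the horizon [t]: the lemma
    is used both on a bounded interval, to show that a solution does not
    vanish in finite time, and up to infinity, to bound its rate of decay. *)
Lemma energy_lower_bound u f D (s L : R) : 0 < s -> 0 <= L ->
  (forall i (t : R), 0 < t ->
    is_derive t 1 (fun s => u s i ord0) (f t i ord0 - D i * u t i ord0)) ->
  u s != 0 ->
  exists c K : R, 0 < c /\ forall t, s <= t ->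
    (forall x, s <= x <= t -> `|f x| <= L * `|u x|) ->
    c * expR (- K * t) <= energy (u t).
Proof.
move=> s0 L0 ud us0.
have [Lam LamP] : exists Lam : R, forall i, D i <= Lam.
  exists (\sum_i `|D i|) => i; rewrite (le_trans (ler_norm _))// (bigD1 i)//= lerDl.
  exact: sumr_ge0.
pose K := 2 * (Lam + d%:R * L).
exists (expR (K * s) * energy (u s)), K; split.
  by rewrite mulr_gt0 ?expR_gt0// energy_gt0.
move=> t st fL; rewrite mulNr expRN ler_pdivrMr ?expR_gt0// [leRHS]mulrC -lerN2.
pose de x := \sum_(i < d) 2 * u x i ord0 * (f x i ord0 - D i * u x i ord0).
apply: (@is_derive_le0_nincr _ (fun x => - (expR (K * x) * energy (u x)))
  (fun x => - (K * expR (K * x) * energy (u x) + expR (K * x) * de x)) s t st).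
  move=> x /andP[sx _]; have x0 : 0 < x := lt_le_trans s0 sx.
  apply: is_deriveN; apply: is_derive_prod (is_derive_expRM _ _) _.
  by apply: energy_derive => i; exact: ud.
move=> x sxt; rewrite oppr_le0.
have -> : K * expR (K * x) * energy (u x) + expR (K * x) * de x
  = expR (K * x) * (K * energy (u x) + de x) by ring.
rewrite mulr_ge0 ?expR_ge0//.
have := inner_bound L0 (fL _ sxt).
rewrite ler_norml => /andP[h _].
have h2 : \sum_(i < d) D i * u x i ord0 ^+ 2 <= Lam * energy (u x).
  by rewrite mulr_sumr ler_sum// => i _; rewrite ler_wpM2r ?sqr_ge0.
have -> : de x = 2 * (\sum_(i < d) u x i ord0 * f x i ord0)
     - 2 * \sum_(i < d) D i * u x i ord0 ^+ 2.
  by rewrite !mulr_sumr -sumrB; apply: eq_bigr => i _; ring.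
rewrite /K; lra.
Qed.

(** Eventually [f] is dominated by half of the dissipation, and energy' <= -
    lam energy. *)
Lemma energy_decay u f D (lam : R) : 0 < lam ->
  (forall i, lam <= D i) ->
  (forall i (t : R), 0 < t ->
    is_derive t 1 (fun s => u s i ord0) (f t i ord0 - D i * u t i ord0)) ->
  (forall eta, 0 < eta -> \forall t \near +oo, `|f t| <= eta * `|u t|) ->
  expO (lam / 2) u.
Proof.
move=> lam0 lamD ud fu.
(* The factor d is the price of estimating an inner product by sup norms. *)
pose L := lam / 2 / (d%:R + 1).
have d1 : 0 < d%:R + 1 :> R by rewrite ltr_wpDl.
have L0 : 0 < L by rewrite !divr_gt0.
have dL : d%:R * L <= lam / 2.
  by rewrite /L mulrA ler_pdivrMr// mulrC ler_wpM2l ?lerDl// divr_ge0// ltW.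
have [T T0 fT] := near_pinfty_ex (fu L L0).
pose s := T + 1; have s0 : 0 < s by rewrite ltr_wpDl.
have fL x : s <= x -> `|f x| <= L * `|u x|.
  by move=> sx; apply: fT; apply: lt_le_trans sx; rewrite ltrDl.
pose de x := \sum_(i < d) 2 * u x i ord0 * (f x i ord0 - D i * u x i ord0).
have dec t : s <= t -> expR (lam * t) * energy (u t) <= expR (lam * s) * energy (u s).
  move=> st; apply: (@is_derive_le0_nincr _ (fun x => expR (lam * x) * energy (u x))
    (fun x => lam * expR (lam * x) * energy (u x) + expR (lam * x) * de x) _ _ st).
    move=> x /andP[sx _]; have x0 : 0 < x := lt_le_trans s0 sx.
    apply: is_derive_prod (is_derive_expRM _ _) _.
    by apply: energy_derive => i; exact: ud.
  move=> x /andP[sx _]; 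
  have -> : lam * expR (lam * x) * energy (u x) + expR (lam * x) * de x
    = expR (lam * x) * (lam * energy (u x) + de x) by ring.
  rewrite pmulr_rle0 ?expR_gt0//.
  have := inner_bound (ltW L0) (fL _ sx).
  rewrite ler_norml => /andP[_ h].
  have h3 : d%:R * L * energy (u x) <= lam / 2 * energy (u x).
    by rewrite ler_wpM2r ?energy_ge0.
  have h2 : lam * energy (u x) <= \sum_(i < d) D i * u x i ord0 ^+ 2.
    by rewrite mulr_sumr ler_sum// => i _; rewrite ler_wpM2r ?sqr_ge0.
  have -> : de x = 2 * (\sum_(i < d) u x i ord0 * f x i ord0)
     - 2 * \sum_(i < d) D i * u x i ord0 ^+ 2.
    by rewrite !mulr_sumr -sumrB; apply: eq_bigr => i _; ring.
  lra.
exists (Num.sqrt (expR (lam * s) * energy (u s))); near=> t.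
have st : s <= t by near: t; exact: near_pinfty_ge.
rewrite -[leLHS]ger0_norm// -sqrtr_sqr.
have -> : expR (- (lam / 2) * t) = Num.sqrt (expR (- lam * t)).
  have -> : - lam * t = - (lam / 2) * t + - (lam / 2) * t by lra.
  by rewrite expRD -expr2 sqrtr_sqr ger0_norm ?expR_ge0.
rewrite -sqrtrM ?mulr_ge0 ?expR_ge0 ?energy_ge0// ler_wsqrtr//.
apply: (le_trans (norm_energy _)).
by rewrite mulNr expRN ler_pdivlMr ?expR_gt0// mulrC dec.
Unshelve. all: by end_near. Qed.

Lemma expO_powR u f (a b C : R) : 0 <= b ->
  (\forall t \near +oo, `|f t| <= C * `|u t| `^ b) ->
  expO a u -> expO (a * b) f.
Proof.
move=> b0 fu [M uM]; exists (`|C| * `|M| `^ b); near=> t.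
apply: (@le_trans _ _ (C * `|u t| `^ b)); first by near: t.
apply: (@le_trans _ _ (`|C| * `|u t| `^ b)).
  by rewrite ler_wpM2r ?powR_ge0// ler_norm.
rewrite -mulrA ler_wpM2l//.
have -> : expR (- (a * b) * t) = expR (- a * t) `^ b.
  by rewrite /powR gt_eqF ?expR_gt0// expRK; congr expR; ring.
rewrite -powRM ?expR_ge0//.
apply: ge0_ler_powR; rewrite ?nnegrE ?mulr_ge0 ?expR_ge0//.
apply: (@le_trans _ _ (M * expR (- a * t))); first by near: t.
by rewrite ler_wpM2r ?expR_ge0// ler_norm.
Unshelve. all: by end_near. Qed.

Lemma coord_expansion u f D (rho rho' : R) :
  (forall i (t : R), 0 < t ->
    is_derive t 1 (fun s => u s i ord0) (f t i ord0 - D i * u t i ord0)) ->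
  expO rho f -> rho' < rho ->
  exists c : 'I_d -> R,
    (forall i, expO rho' (fun t => u t i ord0 - c i * expR (- D i * t))) /\
    (forall i, c i != 0 -> D i < rho').
Proof.
move=> ud frho rr.
have H i : exists c : R, expO rho' (fun t => u t i ord0 - c * expR (- D i * t)) /\
    (c != 0 -> D i < rho').
  exact: (scalar_ode_decay (ud i) (expO_entry i ord0 frho) rr).
exists (fun i => sval (cid (H i))); split=> i; case: cid => c []//.
Qed.

(** As long as no mode has appeared, a decay rate [a] of [u] improves to a +
    kap, with a gain that does not depend on [a]. The lower bound on the
    energy forbids this to go on, so at some stage a nonzero mode appears;
    those with the smallest rate form the leading term. *)
Lemma leading_diagonal u f D (a0 b C c K : R) : 0 < a0 -> 1 < b ->
  (forall i (t : R), 0 < t ->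
    is_derive t 1 (fun s => u s i ord0) (f t i ord0 - D i * u t i ord0)) ->
  (\forall t \near +oo, `|f t| <= C * `|u t| `^ b) ->
  expO a0 u ->
  0 < c -> (\forall t \near +oo, c * expR (- K * t) <= energy (u t)) ->
  exists i0 (xi : U), [/\ xi != 0, forall i, D i != D i0 -> xi i ord0 = 0 &
    small (D i0) (fun t => u t - expR (- D i0 * t) *: xi)].
Proof.
move=> a00 b1 ud fu ua0 c0 low.
(* A rate a >= a0 for u gives the rate a * b >= a + 2 kap for f, and half of
   this gain is lost in scalar_ode_decay. *)
pose kap := a0 * (b - 1) / 2.
have kap0 : 0 < kap by rewrite !mulr_gt0// subr_gt0.
apply: contrapT => nolead.
have all_n n : expO (a0 + n%:R * kap) u.
  elim: n => [|n IH]; first by rewrite mul0r addr0.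
  set a := a0 + n%:R * kap in IH.
  have aa0 : a0 <= a by rewrite lerDl mulr_ge0// ltW.
  have fb : expO (a * b) f by apply: expO_powR fu IH; lra.
  have rr : a + kap < a * b.
    have : a0 * (b - 1) <= a * (b - 1) by rewrite ler_wpM2r// subr_ge0 ltW.
    have : 0 < a0 * (b - 1) by rewrite mulr_gt0// subr_gt0.
    rewrite /kap; lra.
  have [cf [cP cD]] := coord_expansion ud fb rr.
  have -> : a0 + n.+1%:R * kap = a + kap by rewrite /a -natr1; ring.
  have [c00|] := pselect (forall i, cf i = 0).
    apply: expO_entries => i; apply: expO_eq (cP i) => t.
    by rewrite c00 mul0r subr0.
  move/existsNP => [i1 /eqP ci1]; exfalso; apply: nolead.
  have [i0 ci0 i0min] := @Order.TotalTheory.arg_minP _ _ _ i1 (fun i => cf i != 0) D ci1.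
  exists i0, (\col_i (if D i == D i0 then cf i else 0)); split.
  - apply/negP => /eqP/matrixP/(_ i0 ord0); rewrite !mxE eqxx.
    by move/eqP; rewrite (negbTE ci0).
  - by move=> i; rewrite mxE => /negbTE ->.
  - apply: small_entries => i.
    apply: (@small_eq _ _ _ (fun t => (u t i ord0 - cf i * expR (- D i * t)) +
      (if D i == D i0 then 0 else cf i) * expR (- D i * t))).
      move=> t; rewrite !mxE; case: eqP => [->|_]; ring.
    apply: smallD.
      by apply: expO_small (cP i); exact: cD.
    case: eqP => Di.
      by apply: (small_eq _ (small0 _ _)) => t; rewrite mul0r.
    have [->|ci] := eqVneq (cf i) 0.
      by apply: (small_eq _ (small0 _ _)) => t; rewrite mul0r.
    apply: (@expO_small _ _ _ (D i)).
      rewrite lt_def i0min// andbT; exact/eqP.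
    have := expOZexp (D i) (expO_cst (cf i : R^o)); rewrite addr0.
    by apply: expO_eq => t; rewrite /GRing.scale/= mulrC.
have [n nK] : exists n : nat, K / kap < n%:R.
  exists (Num.bound `|K / kap|); apply: le_lt_trans (ler_norm _) _.
  by rewrite archi_boundP.
pose a := a0 + n%:R * kap.
have Ka : K < a + a.
  have h : K < n%:R * kap by rewrite -ltr_pdivrMr.
  have h0 : 0 <= n%:R * kap by rewrite mulr_ge0// ltW.
  rewrite /a; lra.
have eu : expO (a + a) (fun t => energy (u t)).
  have h : expO (a + a) (fun t => (`|u t| : R) *: (`|u t| : R^o)).
    have hn : expO a (fun t => `|u t| : R^o).
      apply: (@expO_dom _ _ _ _ _ _ 1) (all_n n); near=> t.
      by rewrite normr_id mul1r.
    exact: (expOM hn hn).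
  apply: (@expO_dom _ _ _ _ _ _ d%:R) h; near=> t.
  rewrite ger0_norm ?energy_ge0// /GRing.scale/= -expr2 ger0_norm ?sqr_ge0//.
  exact: energy_norm.
have := expO_small Ka eu => -[e e0 [M /near_pinfty_ex[T T0 TM]]].
have [T' T'0 lowT] := near_pinfty_ex low.
(* At a time t > M / (c e), the two bounds contradict c (1 + e t) <= c
   e^{et}. *)
pose t := Num.max (Num.max T T') (M / (c * e)) + 1.
have tT : T < t by rewrite ltr_pwDr// !le_max lexx.
have tT' : T' < t by rewrite ltr_pwDr// !le_max lexx orbT.
have tM : M / (c * e) < t by rewrite ltr_pwDr// !le_max lexx orbT.
have t0 : 0 < t by apply: le_lt_trans tT.
have := le_trans (lowT _ tT') (le_trans (ler_norm _) (TM _ tT)).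
have -> : - (K + e) * t = - K * t + - (e * t) by ring.
rewrite expRD mulrCA [leRHS]mulrC  ler_pM2r ?expR_gt0// expRN.
rewrite ler_pdivlMr ?expR_gt0// => h.
have : c * (1 + e * t) <= M.
  by apply: le_trans h; rewrite ler_wpM2l ?(ltW c0)// expR_ge1Dx.
move: tM; rewrite ltr_pdivrMr ?mulr_gt0// => tM.
rewrite mulrDr mulr1 mulrA => h3; lra.
Unshelve. all: by end_near. Qed.

End Diagonal.

(** * Multilinear maps on lists of vectors *)

Section Multilinear.
Context {R : realType}.

(** One predicate for all arities: each instance relates lists of the same
    length only. *)
Definition multilinear (U W : lmodType R) (T : seq U -> W) : Prop :=
  forall s1 s2 (a : R) (u v : U),
    T (s1 ++ (a *: u + v) :: s2) = a *: T (s1 ++ u :: s2) + T (s1 ++ v :: s2).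

Lemma multilinear_cons (U W : lmodType R) (T : seq U -> W) v :
  multilinear T -> multilinear (fun s => T (v :: s)).
Proof. by move=> mT s1 s2 a u w; exact: (mT (v :: s1)). Qed.

Lemma multilinear0 (U W : lmodType R) (T : seq U -> W) s1 s2 :
  multilinear T -> T (s1 ++ 0 :: s2) = 0.
Proof.
move=> mT; have := mT s1 s2 1 0 0; rewrite scaler0 addr0 scale1r => E.
by apply: (addIr (T (s1 ++ 0 :: s2))); rewrite add0r -E.
Qed.

Lemma multilinear_sum (U W : lmodType R) (T : seq U -> W) (I : Type) (r : seq I)
    (a : I -> R) (v : I -> U) s :
  multilinear T ->
  T (\sum_(i <- r) a i *: v i :: s) = \sum_(i <- r) a i *: T (v i :: s).
Proof.
move=> mT; elim: r => [|i r IH]; first by rewrite !big_nil (multilinear0 [::]).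
by rewrite !big_cons (mT [::]) IH.
Qed.

Lemma multilinear_col (d : nat) (W : lmodType R) (T : seq 'cV[R]_d -> W) v s :
  multilinear T -> T (v :: s) = \sum_i v i ord0 *: T (delta_mx i ord0 :: s).
Proof. by move=> mT; rewrite {1}[v]col_sum_delta multilinear_sum. Qed.

(** The bound is uniform in [x], which pointwise boundedness provides because
    only the finitely many lists of basis vectors matter. With F the
    neighbourhoods of xi it bounds the remainder of a Taylor expansion in all
    directions at once. *)
Lemma multilinear_bounded_near (d : nat) (W : normedModType R) (X : Type)
    (F : set_system X) {FF : Filter F} (T : X -> seq 'cV[R]_d -> W) m :
  (\forall x \near F, multilinear (T x)) ->
  (forall s, exists C : R, \forall x \near F, `|T x s| <= C) ->
  exists2 C : R, 0 <= C & \forall x \near F, forall s, size s = m ->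
    `|T x s| <= C * \prod_(v <- s) `|v|.
Proof.
elim: m T => [|m IH] T mT bT.
  have [C hC] := bT [::]; exists `|C| => //.
  apply: filterS hC => x xC s /size0nil ->.
  by rewrite big_nil mulr1 (le_trans xC)// ler_norm.
have H i : exists2 C : R, 0 <= C & \forall x \near F, forall s, size s = m ->
    `|T x (delta_mx i ord0 :: s)| <= C * \prod_(v <- s) `|v|.
  apply: IH => [|s]; last exact: bT.
  by apply: filterS mT => x; exact: multilinear_cons.
exists (\sum_i s2val (cid2 (H i))).
  by apply: sumr_ge0 => i _; case: cid2.
have H' : \forall x \near F, forall i s, size s = m ->
    `|T x (delta_mx i ord0 :: s)| <= s2val (cid2 (H i)) * \prod_(v <- s) `|v|.
  by apply: filter_forall => i; case: cid2.
apply: filterS2 mT H' => x mx Hx [//|v s] [sm].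
rewrite multilinear_col// big_cons (le_trans (ler_norm_sum _ _ _))//.
rewrite mulr_suml ler_sum// => i _; rewrite normrZ mulrCA ler_pM// ?ler_norm_entry//.
exact: Hx.
Qed.

Lemma multilinear_bounded (d : nat) (W : normedModType R)
    (T : seq 'cV[R]_d -> W) m : multilinear T ->
  exists2 C : R, 0 <= C & forall s, size s = m -> `|T s| <= C * \prod_(v <- s) `|v|.
Proof.
move=> mT.
have [||C C0 h] := @multilinear_bounded_near d W unit (globally setT) _ (fun=> T) m.
- by move=> x _.
- by move=> s; exists `|T s|; move=> x _.
- by exists C => //; apply: (h tt).
Qed.

(** Replace the entries [a] by [b] one at a time. *)
Lemma multilinear_diag_lipschitz (d : nat) (W : normedModType R)
    (T : seq 'cV[R]_d -> W) m : multilinear T ->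
  exists C : R, forall a b, `|a| <= 1 -> `|b| <= 1 ->
    `|T (nseq m a) - T (nseq m b)| <= C * `|a - b|.
Proof.
move=> mT; have [C C0 TC] := multilinear_bounded m mT.
exists (m%:R * C) => a b a1 b1.
have ns k (c : 'cV[R]_d) : `|c| <= 1 -> 0 <= \prod_(v <- nseq k c) `|v| <= 1.
  move=> c1; rewrite prodr_ge0//=; elim: k => [|k IH]; rewrite ?big_nil//.
  by rewrite /= big_cons mulr_ile1// prodr_ge0.
have : forall i j, (j + i = m)%N ->
    `|T (nseq j b ++ nseq i a) - T (nseq m b)| <= i%:R * C * `|a - b|.
  elim=> [|i IH] j jm.
    by rewrite cats0 -jm addn0 subrr normr0 !mul0r.
  have E : T (nseq j b ++ nseq i.+1 a) =
    T (nseq j b ++ (a - b) :: nseq i a) + T (nseq j.+1 b ++ nseq i a).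
    rewrite -[j.+1]addn1 nseqD -catA /=.
    have := mT (nseq j b) (nseq i a) 1 (a - b) b.
    by rewrite !scale1r subrK.
  rewrite E -addrA (le_trans (ler_normD _ _))// -natr1 !mulrDl [leRHS]addrC lerD//; last first.
    by apply: IH; rewrite addSnnS.
  rewrite mul1r (le_trans (TC _ _))//.
    by rewrite size_cat /= !size_nseq.
  rewrite ler_wpM2l// big_cat/= big_cons mulrCA ler_piMr//.
  by have /andP[? ?] := ns j b b1; have /andP[? ?] := ns i a a1; rewrite mulr_ile1.
by move=> /(_ m 0%N); rewrite add0n; apply.
Qed.

End Multilinear.

(** * Iterated differentials and Taylor expansion *)

Section Smooth.
Context {R : realType} {d : nat}.
Local Notation U := 'cV[R]_d.
Variables (V : set U) (oV : open V).
Implicit Types (f g G : U -> U).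

Lemma smooth_on_diff f v : smooth_on V f -> smooth_on V (fun x => 'd f x v).
Proof. by move=> sf k; have [_] := sf k.+1; exact. Qed.

Lemma smooth_iter_diff f s : smooth_on V f -> smooth_on V (iter_diff f s).
Proof. by move=> sf; elim: s => //= v s IH; exact: smooth_on_diff. Qed.

Lemma smooth_differentiable f x : smooth_on V f -> V x -> differentiable f x.
Proof. by move=> sf Vx; have [+ _] := sf 1%N; exact. Qed.

Lemma smooth_continuous f x : smooth_on V f -> V x -> {for x, continuous f}.
Proof. by move=> sf Vx; have := sf 0%N; exact. Qed.

(** Linearity in the outermost slot is that of the differential. For an inner
    slot, the two sides are functions that agree on the open set V, hence have
    the same differential at its points. *)
Lemma iter_diff_multilinear f x : smooth_on V f -> V x ->
  multilinear (fun s => iter_diff f s x).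
Proof.
move=> sf + s1; elim: s1 x => [|w s1 IH] x Vx s2 a u v /=.
  exact: linearP.
have s3 t := smooth_iter_diff t sf.
pose g z := a *: iter_diff f (s1 ++ u :: s2) z + iter_diff f (s1 ++ v :: s2) z.
have dg : is_diff x g (a \*: 'd (iter_diff f (s1 ++ u :: s2)) x
   + 'd (iter_diff f (s1 ++ v :: s2)) x).
  apply: is_diffD; first apply: is_diffZ;
    exact: differentiableP (smooth_differentiable (s3 _) Vx).
case: dg => dg dgE.
transitivity ('d g x w); last exact: (congr1 (fun h : U -> U => h w) dgE).
have fgx : \forall z \near x, iter_diff f (s1 ++ (a *: u + v) :: s2) z = g z.
  apply: filterS (open_nbhs_nbhs (conj oV Vx)) => z Vz; exact: IH.
have df := smooth_differentiable (s3 (s1 ++ (a *: u + v) :: s2)) Vx.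
transitivity ('D_w g x); last exact: deriveE.
transitivity ('D_w (iter_diff f (s1 ++ (a *: u + v) :: s2)) x).
  by symmetry; exact: deriveE.
exact: near_eq_derive.
Qed.

Lemma is_derive_line g (x h : U) (t : R) : differentiable g (x + t *: h) ->
  is_derive t 1 (fun s : R => g (x + s *: h)) ('d g (x + t *: h) h).
Proof.
move=> dg; have dh : derivable g (x + t *: h) h by exact: diff_derivable.
have E : (fun s : R => s^-1 *: (g (s *: h + (x + t *: h)) - g (x + t *: h))) =
  (fun s : R => s^-1 *: (g (x + (s *: 1 + t) *: h) - g (x + t *: h))).
  apply/funext => s; congr (_ *: (g _ - _)).
  by rewrite [s *: 1]mulr1 scalerDl addrCA.
have <- : 'D_h g (x + t *: h) = 'd g (x + t *: h) h by exact: deriveE.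
apply: DeriveDef.
  by move: dh; rewrite /derivable /= E.
by rewrite /derive /= E.
Qed.

End Smooth.

Section Taylor.
Context {R : realType}.

(** The derivative of the error at order M + 1 is the error at order M for the
    shifted family psi_1, psi_2, ..., so induction applies. The factor 1/M! in
    the bound is given up: B t^{M+1} is anyway at least a primitive of B
    t^M. *)
Lemma taylor_scalar M (psi : nat -> R -> R) (B : R) :
  (forall j (t : R), (j < M)%N -> 0 <= t <= 1 -> is_derive t 1 (psi j) (psi j.+1 t)) ->
  (forall t, 0 <= t <= 1 -> `|psi M t| <= B) ->
  forall t, 0 <= t <= 1 ->
    `|psi 0%N t - (\sum_(j < M) (psi j 0 / j`!%:R) *: 'X^j).[t]| <= B * t ^+ M.
Proof.
elim: M psi => [|M IH] psi dpsi bpsi t t01.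
  by rewrite big_ord0 horner0 subr0 expr0 mulr1 bpsi.
pose Q := \sum_(j < M) (psi j.+1 0 / j`!%:R) *: 'X^j.
pose P := \sum_(j < M.+1) (psi j 0 / j`!%:R) *: 'X^j.
have IH' : forall t, 0 <= t <= 1 -> `|psi 1%N t - Q.[t]| <= B * t ^+ M.
  by apply: (IH (fun j => psi j.+1)) => // j s jM; exact: dpsi.
have B0 : 0 <= B by apply: le_trans (bpsi t t01).
have PQ : P^`() = Q.
  rewrite /P big_ord_recl derivD derivZ derivXn mulr0n scaler0 add0r.
  rewrite (big_morph _ (@derivD _) (@deriv0 _)); apply: eq_bigr => i _.
  rewrite derivZ derivXn /=.
  rewrite -[X in _ *: X]scaler_nat scalerA; congr (_ *: _).
  rewrite /bump /= add1n factS natrM invfM mulrA mulrAC divfK// pnatr_eq0//.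
pose g s := psi 0%N s - P.[s].
have dg (s : R) : 0 <= s <= 1 -> is_derive s 1 g (psi 1%N s - Q.[s]).
  move=> s01; have h := @is_derive_poly _ P s; rewrite PQ in h.
  apply: is_deriveB (dpsi 0%N s _ s01) h => //.
have g0 : g 0 = 0.
  rewrite /g /P big_ord_recl hornerD hornerZ hornerXn expr0 mulr1 fact0 divr1.
  rewrite horner_sum big1 ?addr0 ?subrr// => i _.
  by rewrite hornerZ hornerXn expr0n mulr0.
have dB (s : R) : is_derive s 1 (fun x : R => B * x ^+ M.+1) (B * (M.+1%:R * s ^+ M)).
  apply: is_derive_cstM.
  have -> : (fun x : R => x ^+ M.+1) = horner ('X^(M.+1) : {poly R}).
    by apply/funext => x; rewrite hornerXn.
  apply: (is_derive_eq (is_derive_poly ('X^(M.+1) : {poly R}) s)).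
  by rewrite derivXn hornerMn hornerXn mulr_natl.
have le_ts (s : R) : 0 <= s <= t -> 0 <= s <= 1.
  by case/andP: t01 => t0 t1 /andP[-> st]; rewrite (le_trans st).
have bd s : 0 <= s <= 1 -> `|psi 1%N s - Q.[s]| <= B * (M.+1%:R * s ^+ M).
  move=> s01; apply: le_trans (IH' s s01) _; rewrite ler_wpM2l//.
  case/andP: s01 => s0 s1; rewrite ler_peMl ?exprn_ge0// ler1n//.
have t0 : 0 <= t by case/andP: t01.
have h1 : g t - B * t ^+ M.+1 <= g 0 - B * 0 ^+ M.+1.
  apply: (@is_derive_le0_nincr _ (fun t => g t - B * t ^+ M.+1)
    (fun s => psi 1%N s - Q.[s] - B * (M.+1%:R * s ^+ M)) _ _ t0) => s /le_ts s01.
    exact: is_deriveB (dg s s01) (dB s).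
  by rewrite subr_le0 (le_trans (ler_norm _))// bd.
have h2 : - g t - B * t ^+ M.+1 <= - g 0 - B * 0 ^+ M.+1.
  apply: (@is_derive_le0_nincr _ (fun t => - g t - B * t ^+ M.+1)
    (fun s => - (psi 1%N s - Q.[s]) - B * (M.+1%:R * s ^+ M)) _ _ t0) => s /le_ts s01.
    exact: is_deriveB (is_deriveN (dg s s01)) (dB s).
  by rewrite subr_le0 (le_trans (ler_norm _))// normrN bd.
move: h1 h2; rewrite g0 expr0n /= mulr0 oppr0 addr0 => h1 h2.
rewrite ler_norml -/(g t) -/P; apply/andP; split; lra.
Qed.

(** The scalar formula along the segment from xi to xi + h, whose M-th
    derivative is D^M G applied to (h, ..., h). *)
Lemma taylor_smooth (d : nat) (V : set 'cV[R]_d) (G : 'cV[R]_d -> 'cV[R]_d) xi M :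
  open V -> V xi -> smooth_on V G ->
  exists r C : R, [/\ 0 < r, 0 <= C & forall h, `|h| < r ->
    `|G (xi + h) - \sum_(m < M) taylor_coef G xi (nseq m h)| <= C * `|h| ^+ M].
Proof.
move=> oV Vxi sG.
have Vn : \forall x \near xi, V x := open_nbhs_nbhs (conj oV Vxi).
have [||C C0 hC] := @multilinear_bounded_near R d _ _ (nbhs xi) _
    (fun x s => iter_diff G s x) M.
- by apply: filterS Vn => x Vx; exact: iter_diff_multilinear sG Vx.
- move=> s; exists (`|iter_diff G s xi| + 1).
  have := smooth_continuous (smooth_iter_diff s sG) Vxi.
  move=> /cvgrPdist_lt/(_ 1 ltr01); apply: filterS => x xP.
  rewrite -[iter_diff G s x](subKr (iter_diff G s xi)).
  by rewrite (le_trans (ler_normB _ _))// lerD2l ltW.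
have : \forall x \near xi, V x /\ forall s, size s = M ->
    `|iter_diff G s x| <= C * \prod_(v <- s) `|v| by exact: filterI.
move=> /nbhs_ballP[r /= r0 rP].
exists r, C; split=> // h hr.
have inb (t : R) : 0 <= t <= 1 -> ball xi r (xi + t *: h).
  move=> /andP[t0 t1]; rewrite -ball_normE/= opprD addNKr normrN normrZ.
  by rewrite ger0_norm// (le_lt_trans _ hr)// ler_piMl.
apply: mx_norm_le_entries => [|i j]; first by rewrite mulr_ge0// exprn_ge0.
rewrite ord1.
pose psi k (t : R) := iter_diff G (nseq k h) (xi + t *: h) i ord0.
have := @taylor_scalar M psi (C * `|h| ^+ M).
move=> /(_ _ _ 1); rewrite expr1n mulr1 ler01 lexx => /(_ _ _ isT).
have -> : psi 0%N 1 - (\sum_(k < M) (psi k 0 / k`!%:R) *: 'X^k).[1]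
  = (G (xi + h) - \sum_(m < M) taylor_coef G xi (nseq m h)) i ord0.
  rewrite !mxE summxE horner_sum /psi /= scale1r; congr (_ - _).
  apply: eq_bigr => k _; rewrite hornerZ hornerXn expr1n mulr1 scale0r addr0.
  by rewrite /taylor_coef size_nseq mxE mulrC.
apply.
- move=> k t kM t01; have [Vx _] := rP _ (inb t t01).
  have := is_derive_line (smooth_differentiable (smooth_iter_diff (nseq k h) sG) Vx).
  by move=> /(@is_derive_entry _ _ _ _ _ _ i ord0).
- move=> t t01; have [_ hx] := rP _ (inb t t01).
  rewrite (le_trans (ler_norm_entry _ _ _))// (le_trans (hx _ _)) ?size_nseq//.
  by rewrite big_nseq iter_mulr_1.
Qed.

End Taylor.

(** * Enumeration of the exponents *)

Section Enumeration.
Context {R : realType}.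
Implicit Types (S : set R) (mut : nat -> R).

Lemma seq_min (r : seq R) x0 : x0 \in r ->
  exists2 m, m \in r & forall x, x \in r -> m <= x.
Proof.
elim: r x0 => // a r IH x0 _.
case: r IH => [_|b r IH].
  by exists a; rewrite ?mem_head// => x; rewrite inE => /eqP ->.
have [m mr mP] := IH b (mem_head _ _).
have [am|ma] := leP a m.
  exists a; rewrite ?mem_head// => x; rewrite inE => /orP[/eqP -> //|/mP].
  exact: le_trans.
exists m; first by rewrite in_cons mr orbT.
by move=> x; rewrite inE => /orP[/eqP ->|/mP//]; exact: ltW.
Qed.

Lemma strictly_increasing mut :
  (forall n, (0 < n)%N -> mut n < mut n.+1) ->
  forall m n, (0 < m)%N -> (m < n)%N -> mut m < mut n.
Proof.
move=> mutS m + m0; elim=> // n IH; rewrite ltnS leq_eqVlt => /orP[/eqP <-|mn].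
  exact: mutS.
by apply: lt_trans (IH mn) (mutS _ _); exact: leq_trans mn.
Qed.

(** Iterate the map that sends x to the least element of S above x. An element
    missed by the iteration would have infinitely many elements of S below
    it. *)
Lemma locally_finite_enumeration S : S 0 -> (forall s, S s -> 0 <= s) ->
  (forall B, finite_set [set s | S s /\ s <= B]) ->
  (forall B, exists2 s, S s & B < s) ->
  exists2 mut, enumerates mut S & mut 1%N = 0.
Proof.
move=> S0 Sge Sfin Sunb.
have nextP x : exists m, [/\ S m, x < m & forall s, S s -> x < s -> m <= s].
  have [s0 Ss0 xs0] := Sunb x.
  have /finite_seqP[r rE] : finite_set [set s | (S s /\ s <= s0) /\ x < s].
    by apply: sub_finite_set (Sfin s0) => s [].
  have rP s : s \in r <-> (S s /\ s <= s0) /\ x < s.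
    change ([set` r] s <-> [set s | (S s /\ s <= s0) /\ x < s] s).
    by rewrite rE.
  have s0r : s0 \in r by apply/rP.
  have [m /rP[[Sm ms0] xm] mP] := seq_min s0r.
  exists m; split=> // s Ss xs; have [ss0|/ltW s0s] := leP s s0.
    by apply: mP; apply/rP.
  exact: le_trans s0s.
pose nx x := sval (cid (nextP x)).
have nxP x : [/\ S (nx x), x < nx x & forall s, S s -> x < s -> nx x <= s].
  exact: (svalP (cid (nextP x))).
pose mut n := iter n.-1 nx 0.
have mutS n : (0 < n)%N -> mut n.+1 = nx (mut n) by case: n.
have mut_lt n : (0 < n)%N -> mut n < mut n.+1.
  by move=> n0; rewrite mutS//; have [] := nxP (mut n).
have Smut n : (0 < n)%N -> S (mut n).
  elim: n => // -[|n] IH _ //; rewrite mutS//; by have [] := nxP (mut n.+1).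
exists mut => //; split=> // s; split; last first.
  by move=> [n n0 ->]; exact: Smut.
move=> Ss; apply: contrapT => /forall2NP nE.
have lt_s n : (0 < n)%N -> mut n < s.
  elim: n => // -[|n] IH _.
    rewrite lt_def Sge// andbT; apply/eqP => s0.
    by case: (nE 1%N) => //; rewrite /mut /= => /(_ s0).
  rewrite lt_def; apply/andP; split.
    by apply/eqP => sE; case: (nE n.+2).
  by rewrite mutS//; have [_ _] := nxP (mut n.+1); apply => //; exact: IH.
have /finite_seqP[r rE] := Sfin s.
(* One more element below s than r can hold. *)
have : (size [seq mut n | n <- iota 1 (size r).+1] <= size r)%N.
  apply: uniq_leq_size.
    rewrite map_inj_in_uniq ?iota_uniq// => i j.
    rewrite !mem_iota => /andP[i0 _] /andP[j0 _] ij.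
    have [ij'|ji|//] := ltngtP i j.
      by have := strictly_increasing mut_lt i0 ij'; rewrite ij ltxx.
    by have := strictly_increasing mut_lt j0 ji; rewrite ij ltxx.
  move=> _ /mapP[n + ->]; rewrite mem_iota => /andP[n0 _].
  have : [set` r] (mut n) by rewrite -rE; split; [exact: Smut|exact/ltW/lt_s].
  by [].
by rewrite size_map size_iota ltnn.
Qed.

End Enumeration.

Section Stilde.
Context {R : realType}.
Variables (dstar : nat) (lam : nat -> R) (n0 : nat) (K : option nat).
Variables (beta : nat -> R).
Local Notation S := (Stilde dstar lam n0 K beta).

(** The generators of [Stilde] as an additive monoid. *)
Definition generator : set R :=
  [set g | (exists2 k, (n0 < k <= dstar)%N & g = lam k - lam n0) \/
           (exists2 j, in_range K j & g = (beta j - 1) * lam n0)].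

Lemma sum_nat_delta (a b k : nat) (P : pred nat) (f : nat -> R) :
  (a <= k < b)%N -> P k ->
  \sum_(a <= i < b | P i) (i == k)%:R * f i = f k.
Proof.
move=> kab Pk; rewrite big_mkcond (bigD1_seq k) ?iota_uniq ?mem_index_iota//=.
rewrite eqxx Pk mul1r big1 ?addr0// => i /negbTE ->; rewrite mul0r.
by case: ifP.
Qed.

Lemma Stilde_0 : S 0.
Proof.
exists (fun=> 0%N), (fun=> 0%N), 0%N.
by rewrite !big1 ?addr0// => i _; rewrite !mul0r.
Qed.

Lemma Stilde_gen g s : generator g -> S s -> S (g + s).
Proof.
move=> [[k /andP[nk kd] ->]|[j jK ->]] [m [z [L ->]]].
  exists (fun i => m i + (i == k))%N, z, L.
  rewrite addrA; congr (_ + _).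
  under [in RHS]eq_bigr do rewrite natrD mulrDl.
  rewrite big_split/= addrC; congr (_ + _).
  by rewrite sum_nat_delta// ltnS (ltnW nk).
exists m, (fun i => (if (i < L.+1)%N then z i else 0) + (i == j))%N, (maxn L j).
rewrite addrCA; congr (_ + _).
under [in RHS]eq_bigr do rewrite natrD !mulrDl.
rewrite big_split/= [RHS]addrC; congr (_ + _).
  under [in RHS]eq_bigr do rewrite -mulrA.
  rewrite sum_nat_delta// ltnS leq_maxr andbT.
  by case/andP: jK.
rewrite (@big_nat_widen _ _ _ 1 L.+1 (maxn L j).+1) ?ltnS ?leq_maxl//.
rewrite big_mkcondr; apply: eq_bigr => i _.
by case: ifP => // _; rewrite !mul0r.
Qed.

(** Listing the generators with repetition makes closure under addition
    immediate and allows induction on the number of generators, which the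
    coefficients [m] and [z] do not. *)
Lemma Stilde_list s : S s <->
  exists2 l : seq R, (forall g, g \in l -> generator g) & s = \sum_(g <- l) g.
Proof.
split; last first.
  move=> [l + ->]; elim: l => [_|g l IH gl]; first by rewrite big_nil; exact: Stilde_0.
  rewrite big_cons; apply: Stilde_gen; first by apply: gl; rewrite mem_head.
  by apply: IH => h hl; apply: gl; rewrite in_cons hl orbT.
pose Q s := exists2 l : seq R, (forall g, g \in l -> generator g) & s = \sum_(g <- l) g.
have Q0 : Q 0 by exists [::]; rewrite ?big_nil.
have QD x y : Q x -> Q y -> Q (x + y).
  move=> [l lg ->] [l' lg' ->]; exists (l ++ l'); last by rewrite big_cat.
  by move=> g; rewrite mem_cat => /orP[/lg|/lg'].
have Qn n g : generator g -> Q (n%:R * g).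
  move=> gg; elim: n => [|n IH]; first by rewrite mul0r.
  rewrite -natr1 mulrDl mul1r; apply: QD => //; exists [:: g].
    by move=> h; rewrite inE => /eqP ->.
  by rewrite big_seq1.
move=> [m [z [L ->]]]; apply: (QD).
  rewrite big_nat_cond; apply: (big_ind Q Q0 QD) => k /andP[/andP[nk kd] _].
  move: nk; rewrite leq_eqVlt => /orP[/eqP <-|nk]; first by rewrite subrr mulr0.
  by apply: Qn; left; exists k => //; rewrite nk.
apply: (big_ind Q Q0 QD) => j jK; rewrite -mulrA.
by apply: Qn; right; exists j.
Qed.

Lemma Stilde_add s s' : S s -> S s' -> S (s + s').
Proof.
move=> /Stilde_list[l lg ->] /Stilde_list[l' lg' ->].
apply/Stilde_list; exists (l ++ l'); last by rewrite big_cat.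
by move=> g; rewrite mem_cat => /orP[/lg|/lg'].
Qed.

Lemma Stilde_generator g : generator g -> S g.
Proof. by move=> gg; rewrite -[g]addr0; apply: Stilde_gen => //; exact: Stilde_0. Qed.

Hypothesis lam_mono : forall j k, (0 < j)%N -> (j < k)%N -> (k <= dstar)%N ->
  lam j < lam k.
Hypothesis n0_range : (0 < n0 <= dstar)%N.
Hypothesis lam_gt0 : 0 < lam n0.
Hypothesis beta_gt1 : forall k, in_range K k -> 1 < beta k.
Hypothesis range1 : in_range K 1.
Hypothesis range_fin : forall B : R, exists J, forall j, in_range K j ->
  (beta j - 1) * lam n0 <= B -> (j < J)%N.

Lemma generator_gt0 g : generator g -> 0 < g.
Proof.
move=> [[k /andP[nk kd] ->]|[j jK ->]].
  by rewrite subr_gt0 lam_mono//; case/andP: n0_range.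
by rewrite mulr_gt0// subr_gt0 beta_gt1.
Qed.

Lemma generator_finite B : finite_set [set g | generator g /\ g <= B].
Proof.
have [J JP] := range_fin B.
apply: (@sub_finite_set _ _ (((fun k => lam k - lam n0) @` `I_dstar.+1) `|`
   ((fun j => (beta j - 1) * lam n0) @` `I_J))).
  move=> g [[[k /andP[nk kd] ->] _|[j jK ->] jB]].
    by left; exists k.
  by right; exists j => //=; exact: JP.
by rewrite finite_setU; split; apply: finite_image; exact: finite_II.
Qed.

Lemma generator_ge_min : exists2 c, 0 < c & forall g, generator g -> c <= g.
Proof.
have /finite_seqP[r rE] := generator_finite 1.
have rP g : g \in r <-> generator g /\ g <= 1.
  by change ([set` r] g <-> [set g | generator g /\ g <= 1] g); rewrite rE.
have [c cr cP] := @seq_min _ (1 :: r) 1 (mem_head _ _).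
exists c.
  move: cr; rewrite inE => /orP[/eqP -> //|/rP[]]; by move/generator_gt0.
move=> g gg; have [g1|/ltW g1] := leP g 1.
  by apply: cP; rewrite inE; apply/orP; right; apply/rP.
by apply: le_trans g1; apply: cP; exact: mem_head.
Qed.

Lemma Stilde_ge0 s : S s -> 0 <= s.
Proof.
move=> /Stilde_list[l lg ->]; rewrite big_seq; apply: sumr_ge0 => g /lg.
by move/generator_gt0/ltW.
Qed.

(** All generators are at least some c > 0. An element that is at most (n+1) c
    is 0 or the sum of one of finitely many generators and an element that is
    at most n c. *)
Lemma Stilde_locally_finite B : finite_set [set s | S s /\ s <= B].
Proof.
have [c c0 cP] := generator_ge_min.
have fin n : finite_set [set s | S s /\ s <= n%:R * c].
  elim: n => [|n IH].
    apply: (@sub_finite_set _ _ [set 0]); last exact: finite_set1.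
    move=> s [Ss]; rewrite mul0r => s0; apply/eqP; rewrite eq_le s0 Stilde_ge0//.
  apply: (@sub_finite_set _ _ ([set 0] `|` [set x + y | x in
      [set g | generator g /\ g <= n.+1%:R * c] &
      y in [set s | S s /\ s <= n%:R * c]])).
    move=> _ [/Stilde_list[[|g l] lg ->] sB]; first by left; rewrite big_nil.
    right; have gg : generator g by apply: lg; rewrite mem_head.
    have Sl : S (\sum_(h <- l) h).
      by apply/Stilde_list; exists l => // h hl; apply: lg; rewrite in_cons hl orbT.
    move: sB; rewrite big_cons => sB.
    exists g.
      by split=> //; apply: le_trans sB; rewrite lerDl Stilde_ge0.
    exists (\sum_(h <- l) h) => //; split=> //.
    by move: sB (cP g gg); rewrite -natr1 mulrDl mul1r; lra.
  rewrite finite_setU; split; first exact: finite_set1.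
  by apply: finite_image2 => //; exact: generator_finite.
apply: sub_finite_set (fin (Num.bound `|B / c|)) => s [Ss sB]; split=> //.
apply: le_trans sB _; rewrite -ler_pdivrMr//.
by rewrite ltW// (le_lt_trans (ler_norm _))// archi_boundP.
Qed.

Lemma Stilde_unbounded B : exists2 s, S s & B < s.
Proof.
have gg : generator ((beta 1%N - 1) * lam n0) by right; exists 1%N.
have g0 := generator_gt0 gg; set g := _ * _ in gg g0.
exists ((Num.bound `|B / g|)%:R * g).
  apply/Stilde_list; exists (nseq (Num.bound `|B / g|) g).
    by move=> h; rewrite mem_nseq => /andP[_ /eqP ->].
  by rewrite big_nseq iter_addr_0 mulr_natl.
by rewrite -ltr_pdivrMr// (le_lt_trans (ler_norm _))// archi_boundP.
Qed.

Lemma Stilde_enumeration : exists2 mut, enumerates mut S & mut 1%N = 0.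
Proof.
apply: locally_finite_enumeration.
- exact: Stilde_0.
- exact: Stilde_ge0.
- exact: Stilde_locally_finite.
- exact: Stilde_unbounded.
Qed.

End Stilde.

(** * Expansion of multilinear maps and vector polynomials *)

Section Words.

(** The words of length [m] over [I]: they index the expansion of an m-linear
    map at a sum over [I]. *)
Fixpoint words (I : seq nat) (m : nat) : seq (seq nat) :=
  if m is m'.+1 then [seq k :: s | k <- I, s <- words I m'] else [:: [::]].

Fixpoint short_words (I : seq nat) (m : nat) : seq (seq nat) :=
  if m is m'.+1 then short_words I m' ++ words I m' else [::].

Lemma mem_words I m s : (s \in words I m) = (size s == m) && all (mem I) s.
Proof.
elim: m s => [|m IH] s; first by rewrite inE; case: s.
apply/allpairsP/andP => [[[k s'] /= [kI + ->]]|].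
  by rewrite IH => /andP[sm sI] /=; rewrite eqSS kI.
case: s => [|k s] [] //=; rewrite eqSS => sm /andP[kI sI].
by exists (k, s); split; rewrite //= IH sm.
Qed.

Lemma uniq_words I m : uniq I -> uniq (words I m).
Proof.
move=> uI; elim: m => //= m IH; apply: allpairs_uniq => //.
by move=> [a s] [a' s'] _ _ /= [-> ->].
Qed.

Lemma mem_short_words I m s :
  (s \in short_words I m) = (size s < m)%N && all (mem I) s.
Proof.
elim: m => //= m IH; rewrite mem_cat IH mem_words -andb_orl ltnS.
by rewrite [in RHS]leq_eqVlt orbC.
Qed.

Lemma uniq_short_words I m : uniq I -> uniq (short_words I m).
Proof.
move=> uI; elim: m => //= m IH; rewrite cat_uniq IH uniq_words//= andbT.
apply/hasPn => s; rewrite mem_words mem_short_words => /andP[/eqP -> _].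
by rewrite ltnn.
Qed.

Lemma big_short_words (V : nmodType) I m (f : seq nat -> V) :
  \sum_(s <- short_words I m) f s = \sum_(j < m) \sum_(s <- words I j) f s.
Proof.
elim: m => [|m IH]; first by rewrite big_nil big_ord0.
by rewrite big_cat big_ord_recr /= IH.
Qed.

End Words.

Section VectorPolynomials.
Context {R : realType}.

Lemma multilinear_words (U W : lmodType R) (T : seq U -> W) (I : seq nat)
    (v : nat -> U) m :
  multilinear T ->
  T (nseq m (\sum_(k <- I) v k)) = \sum_(s <- words I m) T (map v s).
Proof.
elim: m T => [|m IH] T mT; first by rewrite big_seq1.
rewrite /= big_allpairs_dep /=.
set w := \sum_(k <- I) v k.
have wE : w = \sum_(k <- I) 1 *: v k.
  by apply: eq_bigr => k _; rewrite scale1r.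
rewrite {1}wE multilinear_sum//; apply: eq_bigr => k _.
by rewrite scale1r (IH (fun s => T (v k :: s)))//; exact: multilinear_cons.
Qed.

Lemma multilinear_exp (U W : lmodType R) (T : seq U -> W) (e : nat -> R) (t : R)
    (v : nat -> U) s : multilinear T ->
  T [seq expR (- e k * t) *: v k | k <- s] =
  expR (- (\sum_(k <- s) e k) * t) *: T (map v s).
Proof.
elim: s T => [|k s IH] T mT /=.
  by rewrite big_nil oppr0 mul0r expR0 scale1r.
have := mT [::] [seq expR (- e k * t) *: v k | k <- s] (expR (- e k * t)) (v k) 0.
rewrite /= addr0 (multilinear0 [::])// addr0 => ->.
rewrite (IH (fun s => T (v k :: s))); last exact: multilinear_cons.
by rewrite big_cons scalerA -expRD opprD mulrDl.
Qed.

Variable d : nat.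
Implicit Types f g : R -> 'cV[R]_d.

Lemma vector_polynomial_cst (w : 'cV[R]_d) : vector_polynomial (fun=> w).
Proof.
by exists (map_mx polyC w) => t; apply/matrixP => i j; rewrite !mxE hornerC.
Qed.

Lemma vector_polynomialD f g : vector_polynomial f -> vector_polynomial g ->
  vector_polynomial (fun t => f t + g t).
Proof.
move=> [p pE] [p' pE']; exists (p + p') => t.
by rewrite pE pE'; apply/matrixP => i j; rewrite !mxE hornerD.
Qed.

Lemma vector_polynomial_sum (I : eqType) (r : seq I) (P : pred I)
    (f : I -> R -> 'cV[R]_d) :
  (forall i, i \in r -> P i -> vector_polynomial (f i)) ->
  vector_polynomial (fun t => \sum_(i <- r | P i) f i t).
Proof.
elim: r => [|i r IH] h.
  have -> : (fun t => \sum_(i <- [::] | P i) f i t) = (fun=> 0).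
    by apply/funext => t; rewrite big_nil.
  exact: vector_polynomial_cst.
have hr : vector_polynomial (fun t => \sum_(i <- r | P i) f i t).
  by apply: IH => j jr; apply: h; rewrite in_cons jr orbT.
have [Pi|Pi] := boolP (P i).
  rewrite (_ : (fun t => _) = (fun t => f i t + \sum_(i <- r | P i) f i t)).
    by apply: vector_polynomialD => //; apply: h; rewrite ?mem_head.
  by apply/funext => t; rewrite big_cons Pi.
rewrite (_ : (fun t => _) = (fun t => \sum_(i <- r | P i) f i t))//.
by apply/funext => t; rewrite big_cons (negbTE Pi).
Qed.

Lemma vector_polynomialZ (p : {poly R}) f : vector_polynomial f ->
  vector_polynomial (fun t => p.[t] *: f t).
Proof.
move=> [q qE]; exists (p *: q) => t.
by rewrite qE; apply/matrixP => i j; rewrite !mxE hornerM.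
Qed.

Lemma vector_polynomial_mulmx (M : 'M[R]_d) f : vector_polynomial f ->
  vector_polynomial (fun t => M *m f t).
Proof.
move=> [q qE]; exists (map_mx polyC M *m q) => t.
rewrite qE; apply/matrixP => i j; rewrite !mxE horner_sum.
by apply: eq_bigr => k _; rewrite !mxE hornerM hornerC.
Qed.

Lemma vector_polynomial_entry f i : vector_polynomial f ->
  exists p : {poly R}, forall t, f t i ord0 = p.[t].
Proof. by move=> [q qE]; exists (q i ord0) => t; rewrite qE mxE. Qed.

Lemma expO_vector_polynomial f e : 0 < e -> vector_polynomial f -> expO (- e) f.
Proof.
move=> e0 vf; apply: expO_entries => i.
have [p pE] := vector_polynomial_entry i vf.
by rewrite (_ : (fun t => _) = (fun t => p.[t])); [exact: expO_poly|exact/funext].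
Qed.

(** The polynomial factor is absorbed by half of the gap between the two
    rates. *)
Lemma small_exp_polynomial f (a b : R) : a < b -> vector_polynomial f ->
  small a (fun t => expR (- b * t) *: f t).
Proof.
move=> ab vf; have h : 0 < (b - a) / 2 by rewrite divr_gt0// subr_gt0.
apply: (@expO_small _ _ _ (b + - ((b - a) / 2))); first by lra.
by apply: expOZexp; exact: expO_vector_polynomial.
Qed.

Lemma multilinear_vector_polynomial (T : seq 'cV[R]_d -> 'cV[R]_d)
    (q : nat -> R -> 'cV[R]_d) s :
  multilinear T ->
  (forall k, k \in s -> vector_polynomial (q k)) ->
  vector_polynomial (fun t => T [seq q k t | k <- s]).
Proof.
elim: s T => [|k s IH] T mT vq /=; first exact: vector_polynomial_cst.
rewrite (_ : (fun t => _) = (fun t => \sum_(i <- enum 'I_d)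
    q k t i ord0 *: T (delta_mx i ord0 :: [seq q k t | k <- s]))); last first.
  by apply/funext => t; rewrite multilinear_col// big_enum.
apply: vector_polynomial_sum => i _ _.
have [p pE] := vq k (mem_head _ _).
rewrite (_ : (fun t => _) = (fun t => (p i ord0).[t]
  *: T (delta_mx i ord0 :: [seq q k t | k <- s]))); last first.
  by apply/funext => t; rewrite pE mxE.
apply: vector_polynomialZ; apply: (IH (fun s => T (delta_mx i ord0 :: s))).
  exact: multilinear_cons.
by move=> j js; apply: vq; rewrite in_cons js orbT.
Qed.

Lemma vector_polynomial_derive (q : R -> 'cV[R]_d) (p : 'cV[{poly R}]_d) t :
  (forall t, q t = map_mx (horner^~ t) p) ->
  derive1 q t = map_mx (fun c => c^`().[t]) p.
Proof.
move=> qp; have -> : q = (fun t => map_mx (horner^~ t) p) by apply/funext.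
have E i j : (fun s : R => map_mx (horner^~ s) p i j) = horner (p i j).
  by apply/funext => s; rewrite mxE.
have dq : derivable (fun s : R => map_mx (horner^~ s) p) t 1.
  apply/derivable_mxP => i j; rewrite E; exact: derivable_horner.
rewrite derive1E derive_mx//; apply/matrixP => i j; rewrite !mxE E.
by rewrite -derive1E -derivE.
Qed.

End VectorPolynomials.

(** * The expansion, one exponent at a time *)

Section Expansion.
Context {R : realType} {d : nat}.
Local Notation U := 'cV[R]_d.

Lemma taylor_coef_multilinear (V : set U) (G : U -> U) xi :
  open V -> V xi -> smooth_on V G -> multilinear (taylor_coef G xi).
Proof.
move=> oV Vxi sG s1 s2 a u v; rewrite /taylor_coef.
rewrite (iter_diff_multilinear oV sG Vxi) !size_cat /= scalerDr.
by rewrite !scalerA mulrC.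
Qed.

Variables (V : set U) (F : U -> U) (K : option nat) (beta : nat -> R).
Variables (G : nat -> U -> U) (xi : U) (ls : R) (mut : nat -> R).
Hypothesis oV : open V.
Hypothesis Vxi : V xi.
Hypothesis hG : approx_terms V K beta G.
Hypothesis ls0 : 0 < ls.
Hypothesis mutS : forall n, (0 < n)%N -> mut n < mut n.+1.
Hypothesis mut1 : mut 1%N = 0.
Hypothesis mutD : forall i j, (0 < i)%N -> (0 < j)%N ->
  exists2 k, (0 < k)%N & mut i + mut j = mut k.
Hypothesis mutG : forall r, in_range K r ->
  exists2 k, (0 < k)%N & (beta r - 1) * ls = mut k.

(** The right-hand side of the equation for q_n. *)
Definition forcing (q : nat -> R -> U) (n : nat) (t : R) : U :=
  \sum_(p \in resonant_indices ls K beta mut n)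
      taylor_coef (G p.1) xi [seq q k t | k <- p.2].

Lemma mut_lt m n : (0 < m)%N -> (m < n)%N -> mut m < mut n.
Proof. exact: strictly_increasing. Qed.

Lemma mut_le m n : (0 < m)%N -> (m <= n)%N -> mut m <= mut n.
Proof.
move=> m0; rewrite leq_eqVlt => /orP[/eqP <- //|mn]; exact/ltW/mut_lt.
Qed.

Lemma mut_lt_inv m n : (0 < m)%N -> (0 < n)%N -> mut m < mut n -> (m < n)%N.
Proof. by move=> m0 n0; apply: contraTT; rewrite -leqNgt -leNgt; exact: mut_le. Qed.

Lemma mut_inj m n : (0 < m)%N -> (0 < n)%N -> mut m = mut n -> m = n.
Proof.
move=> m0 n0 mn; have [h|h|//] := ltngtP m n.
  by have := mut_lt m0 h; rewrite mn ltxx.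
by have := mut_lt n0 h; rewrite mn ltxx.
Qed.

Lemma mut_ge0 n : (0 < n)%N -> 0 <= mut n.
Proof. by move=> n0; rewrite -mut1 mut_le. Qed.

Lemma mut_sum s : all (leq 2) s -> exists2 k, (0 < k)%N & \sum_(i <- s) mut i = mut k.
Proof.
elim: s => [_|i s IH /= /andP[i2 /IH[k k0 kE]]].
  by exists 1%N => //; rewrite big_nil mut1.
by rewrite big_cons kE; apply: mutD => //; exact: ltnW.
Qed.

Lemma beta1_gt0 r : in_range K r -> 0 < (beta r - 1) * ls.
Proof. by case: hG => b1 _ _ _ /b1 b; rewrite mulr_gt0// subr_gt0. Qed.

(** The rate, shifted by ls, at which the Taylor term of G_r in the directions
    q_{k_1}, ..., q_{k_m} contributes to F(y). *)
Definition weight (p : nat * seq nat) : R :=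
  \sum_(k <- p.2) mut k + (beta p.1 - 1) * ls.

Lemma weight_mut p : in_range K p.1 -> all (leq 2) p.2 ->
  exists2 k, (0 < k)%N & weight p = mut k.
Proof.
move=> /mutG[k k0 kE] /mut_sum[j j0 jE]; rewrite /weight kE jE; exact: mutD.
Qed.

(** As (beta_r - 1) ls > 0, the equation for q_n involves only earlier
    coefficients: the equations can be solved one after the other. *)
Lemma resonant_lt n p k : (0 < n)%N -> resonant_indices ls K beta mut n p ->
  k \in p.2 -> (2 <= k < n)%N.
Proof.
move=> n0 [pK p2 pE] kp; have k2 : (2 <= k)%N := allP p2 k kp.
rewrite k2 /=; apply: mut_lt_inv => //; first exact: ltnW.
rewrite -pE -[ltLHS]addr0; apply: ler_ltD (beta1_gt0 pK).
rewrite (big_rem k)//= lerDl big_seq; apply: sumr_ge0 => i /mem_rem ip.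
by apply: mut_ge0; apply: (@leq_trans 2) => //; exact: (allP p2).
Qed.

Lemma size_weight p n : all (leq 2) p.2 -> in_range K p.1 ->
  weight p <= mut n -> (size p.2)%:R * mut 2%N <= mut n.
Proof.
move=> p2 pK; apply: le_trans; apply: (@le_trans _ _ (\sum_(k <- p.2) mut k)).
  elim: (p.2) p2 => [|k s IH] /=; first by rewrite big_nil mul0r.
  move=> /andP[k2 /IH h]; rewrite big_cons -natr1 mulrDl mul1r addrC lerD//.
  exact: mut_le.
by rewrite /weight lerDl ltW// beta1_gt0.
Qed.

Lemma forcing_eq q q' n t : (0 < n)%N ->
  (forall k, (0 < k < n)%N -> q k = q' k) -> forcing q n t = forcing q' n t.
Proof.
move=> n0 qq; apply: eq_fsbigr => p /set_mem pn.
congr taylor_coef; apply/eq_in_map => k kp.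
have /andP[k2 kn] := resonant_lt n0 pn kp.
by rewrite qq// kn (ltnW k2).
Qed.

Lemma forcing1 q t : forcing q 1 t = 0.
Proof.
rewrite /forcing fsbig1// => p [pK p2 pE].
have : 0 < weight p.
  rewrite /weight ltr_wpDl ?beta1_gt0//.
  by have [k k0 ->] := mut_sum p2; exact: mut_ge0.
by rewrite /weight pE mut1 ltxx.
Qed.

Section Remainder.
Variables (y : R -> U) (q : nat -> R -> U) (N M : nat) (b : R).
Hypothesis N0 : (0 < N)%N.
Hypothesis vq : forall n, (0 < n <= N)%N -> vector_polynomial (q n).
Hypothesis q1 : forall t, q 1%N t = xi.
Hypothesis yN : small (mut N + ls)
  (fun t => y t - \sum_(1 <= n < N.+1) expR (- (mut n + ls) * t) *: q n t).
Hypothesis rangeM : forall r, (0 < r <= M)%N -> in_range K r.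
Hypothesis resM : forall r, in_range K r -> (beta r - 1) * ls <= mut N.+1 -> (r <= M)%N.
Hypothesis Fb : remainder_bound F G M b.
Hypothesis b0 : 0 <= b.
Hypothesis lsb : mut N.+1 + ls < ls * b.

Let I := index_iota 2 N.+1.
Let etaN t : U := \sum_(k <- I) expR (- mut k * t) *: q k t.
Let rho t : U := expR (- - ls * t) *:
  (y t - \sum_(1 <= n < N.+1) expR (- (mut n + ls) * t) *: q n t).
Let eta t : U := etaN t + rho t.

Let rho_small : small (mut N) rho.
Proof. by have := smallZexp (- ls) yN; rewrite addrCA addNr addr0. Qed.

(** The known part of the expansion is e^{-ls t} (xi + etaN). Hence y = e^{-ls
    t} (xi + eta), where eta = etaN + rho and rho is the rescaled
    remainder. *)
Let sum_eta t : \sum_(1 <= n < N.+1) expR (- (mut n + ls) * t) *: q n t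
  = expR (- ls * t) *: (xi + etaN t).
Proof.
rewrite big_ltn// mut1 add0r q1 scalerDr; congr (_ + _).
rewrite /etaN scaler_sumr; apply: eq_bigr => k _.
by rewrite scalerA -expRD; congr (expR _ *: _); ring.
Qed.

Let y_eta t : y t = expR (- ls * t) *: (xi + eta t).
Proof.
have E : expR (- ls * t) * expR (- - ls * t) = 1.
  by rewrite -expRD -mulrDl subrr mul0r expR0.
by rewrite /eta /rho addrA scalerDr -sum_eta scalerA E scale1r addrC subrK.
Qed.

Let etaN_small : small 0 etaN.
Proof.
apply: small_sum => k; rewrite mem_index_iota => /andP[k2 kN] _.
have k0 : (0 < k)%N by apply: leq_trans k2.
apply: small_exp_polynomial; first by rewrite -mut1 mut_lt.
by apply: vq; rewrite k0.
Qed.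

Let eta_small : small 0 eta.
Proof.
apply: smallD; first exact: etaN_small.
by apply: small_le rho_small; exact: mut_ge0.
Qed.

Let y_expO : expO ls y.
Proof.
apply: (@expO_eq _ _ _ (fun t => expR (- ls * t) *: (xi + eta t))).
  by move=> t; rewrite y_eta.
rewrite -[ls]addr0; apply: expOM; first by rewrite addr0; exact: expO_exp.
by apply: expOD; [exact: expO_cst|exact: small_expO].
Qed.

Let F_remainder : small (mut N.+1 + ls)
  (fun t => F (y t) - \sum_(1 <= r < M.+1) G r (y t)).
Proof.
have [r [C [r0 C0 FC]]] := remainder_bound_norm b0 Fb.
apply: (expO_small lsb); apply: (@expO_powR _ _ y _ ls b C b0 _ y_expO).
apply: filterS (expO_lt ls0 r0 y_expO) => t; exact: FC.
Qed.

(** The Taylor polynomial of degree below [m] at xi, evaluated at eta, makes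
    an error of order |eta|^m, and replacing eta by etaN an error of the order
    of rho. The latter is only small relative to mut N, but the factor
    e^{-(beta_r - 1) ls t} shifts it by an element of the set of exponents,
    hence to mut N.+1 at least. *)
Let G_expansion r m (dlt : R) : in_range K r -> 0 < dlt -> expO dlt eta ->
  mut N.+1 < dlt * m%:R ->
  small (mut N.+1 + ls) (fun t => G r (y t) - \sum_(s <- short_words I m)
    expR (- (weight (r, s) + ls) * t) *: taylor_coef (G r) xi [seq q k t | k <- s]).
Proof.
move=> rK dlt0 etad dm; case: hG => _ _ homG smoothG.
have mT := taylor_coef_multilinear oV Vxi (smoothG r rK).
have [rad [C [rad0 C0 taylorC]]] := taylor_smooth m oV Vxi (smoothG r rK).
pose TS (v : U) := \sum_(j < m) taylor_coef (G r) xi (nseq j v).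
have E t : G r (y t) = expR (- (ls * beta r) * t) *: G r (xi + eta t).
  rewrite y_eta homG ?expR_gt0// /powR gt_eqF ?expR_gt0// expRK.
  by congr (expR _ *: _); ring.
have h1 : small (mut N.+1) (fun t => G r (xi + eta t) - TS (eta t)).
  apply: (expO_small dm); apply: (@expO_powR _ _ eta _ dlt m%:R C) => //.
  apply: filterS (expO_lt dlt0 rad0 etad) => t /taylorC.
  by rewrite powR_mulrn.
have small_N : \forall t \near +oo, `|etaN t| <= 1.
  have [e e0] := etaN_small; rewrite add0r => /(expO_lt e0 ltr01).
  by apply: filterS => t /ltW.
have small_e : \forall t \near +oo, `|eta t| <= 1.
  by apply: filterS (expO_lt dlt0 ltr01 etad) => t /ltW.
have h2 : small (mut N) (fun t => TS (eta t) - TS (etaN t)).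
  apply: (@small_eq _ _ _ (fun t => \sum_(j <- enum 'I_m)
    (taylor_coef (G r) xi (nseq j (eta t)) - taylor_coef (G r) xi (nseq j (etaN t))))).
    by move=> t; rewrite big_enum sumrB.
  apply: small_sum => j _ _.
  have [D DP] := multilinear_diag_lipschitz j mT.
  apply: small_dom rho_small; near=> t.
  rewrite (_ : rho t = eta t - etaN t); last by rewrite /eta addrC addKr.
  by apply: DP; near: t.
have h3 t : TS (etaN t) = \sum_(s <- short_words I m)
    expR (- (\sum_(k <- s) mut k) * t) *: taylor_coef (G r) xi [seq q k t | k <- s].
  rewrite big_short_words; apply: eq_bigr => j _.
  rewrite /etaN (multilinear_words _ _ _ mT); apply: eq_bigr => s _.
  exact: (multilinear_exp _ _ (fun k => q k t)).
apply: (@small_eq _ _ _ (fun t =>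
   expR (- (ls * beta r) * t) *: (G r (xi + eta t) - TS (eta t)) +
   expR (- (ls * beta r) * t) *: (TS (eta t) - TS (etaN t)))).
  move=> t; rewrite -scalerDr subrKA scalerBr E; congr (_ - _).
  rewrite h3 scaler_sumr; apply: eq_bigr => s _; rewrite scalerA -expRD.
  by congr (expR _ *: _); rewrite /weight /=; ring.
have lsb' : ls * beta r = (beta r - 1) * ls + ls by ring.
apply: smallD.
  apply: small_le (smallZexp _ h1); rewrite lsb'.
  have := beta1_gt0 rK; lra.
apply: small_le (smallZexp _ h2); rewrite lsb'.
suff : mut N.+1 <= (beta r - 1) * ls + mut N by lra.
have := beta1_gt0 rK; have [k k0 ->] := mutG rK => mk0.
have [j j0 jE] := mutD k0 N0; rewrite jE; apply: mut_le => //.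
by apply: mut_lt_inv => //; rewrite -jE ltrDr.
Unshelve. all: by end_near. Qed.

(** An order of truncation for which the Taylor remainder is negligible and,
    as dlt <= mut 2, every pair whose word has length at least [m] has weight
    above mut N.+1. *)
Let trunc_ex : exists m (dlt : R), [/\ 0 < dlt, dlt <= mut 2%N, expO dlt eta &
  mut N.+1 < dlt * m%:R].
Proof.
have [e e0] := eta_small; rewrite add0r => he.
have mut20 : 0 < mut 2%N by rewrite -mut1 mut_lt.
pose dlt := Num.min e (mut 2%N).
have d0 : 0 < dlt by rewrite lt_min e0.
exists (Num.bound `|mut N.+1 / dlt|), dlt; split => //.
- by rewrite ge_min lexx orbT.
- by apply: expO_le he; rewrite ge_min lexx.
- rewrite mulrC -ltr_pdivrMr//.
  by rewrite (le_lt_trans (ler_norm _))// archi_boundP.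
Qed.

(** For [m] as above, a finite list that contains every resonant pair of index
    at most N.+1; the other pairs in it have weight above mut N.+1. *)
Let pairs m : seq (nat * seq nat) :=
  [seq (r, s) | r <- index_iota 1 M.+1, s <- short_words I m].

Let mem_pairs m p : (p \in pairs m) =
  [&& (0 < p.1 <= M)%N, (size p.2 < m)%N & all (fun k => 2 <= k <= N)%N p.2].
Proof.
case: p => r s; rewrite /pairs; apply/allpairsP/and3P => [[[r' s'] /= [rM + [-> ->]]]|].
  rewrite mem_short_words => /andP[-> sI]; move: rM; rewrite mem_index_iota ltnS => ->.
  split=> //; apply/allP => k /(allP sI) /=; by rewrite mem_index_iota ltnS.
move=> /= [rM sm sI]; exists (r, s); split=> //=.
  by rewrite mem_index_iota ltnS.
rewrite mem_short_words sm /=; apply/allP => k /(allP sI) /=.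
by rewrite mem_index_iota ltnS.
Qed.

Let pairs_range m p : p \in pairs m -> in_range K p.1 /\ all (leq 2) p.2.
Proof.
rewrite mem_pairs => /and3P[pM _ pN]; split; first exact: rangeM.
by apply/allP => k /(allP pN) /andP[].
Qed.

Let uniq_pairs m : uniq (pairs m).
Proof.
apply: allpairs_uniq; rewrite ?iota_uniq ?uniq_short_words ?iota_uniq//.
by move=> [a s] [a' s'] _ _ /= [-> ->].
Qed.

Let coef p t : U := taylor_coef (G p.1) xi [seq q k t | k <- p.2].

Let coef_polynomial m p : p \in pairs m -> vector_polynomial (coef p).
Proof.
rewrite mem_pairs => /and3P[pM _ pN]; case: hG => _ _ _ smoothG.
apply: multilinear_vector_polynomial.
  exact: taylor_coef_multilinear oV Vxi (smoothG _ (rangeM pM)).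
by move=> k /(allP pN) /andP[k2 kN]; apply: vq; rewrite kN (leq_trans _ k2).
Qed.

Let forcing_pairs m dlt n t : 0 < dlt -> dlt <= mut 2%N -> mut N.+1 < dlt * m%:R ->
  (0 < n <= N.+1)%N ->
  forcing q n t = \sum_(p <- pairs m | weight p == mut n) coef p t.
Proof.
move=> d0 d2 dm /andP[n0 nN]; rewrite /forcing -[RHS]big_filter.
rewrite [RHS]fsbig_seq ?filter_uniq ?uniq_pairs//.
apply: eq_fsbigl; apply/seteqP; split => p /=; last first.
  rewrite mem_filter => /andP[/eqP pn /pairs_range[pK p2]]; split => //.
move=> pn; have [pK p2 pE] := pn; rewrite mem_filter; apply/andP; split.
  exact/eqP.
have nN' : mut n <= mut N.+1 by exact: mut_le.
have pN : weight p <= mut N.+1 by rewrite /weight pE.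
rewrite mem_pairs; apply/and3P; split.
- apply/andP; split; first by case/andP: pK.
  apply: resM => //; apply: le_trans pN; rewrite /weight lerDr.
  by have [k k0 ->] := mut_sum p2; exact: mut_ge0.
- have := size_weight p2 pK pN => h.
  rewrite -(ltr_nat R) -(ltr_pM2l d0); apply: le_lt_trans dm.
  by apply: le_trans h; rewrite mulrC ler_wpM2l.
- apply/allP => k kp; have /andP[-> kn] := resonant_lt n0 pn kp.
  by rewrite -ltnS (leq_trans kn).
Qed.

Lemma forcing_polynomial n : (0 < n <= N.+1)%N -> vector_polynomial (forcing q n).
Proof.
move=> n0; have [m [dlt [d0 d2 _ dm]]] := trunc_ex.
rewrite (_ : forcing q n = (fun t => \sum_(p <- pairs m | weight p == mut n) coef p t)).
  by apply: vector_polynomial_sum => p /coef_polynomial.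
by apply/funext => t; exact: forcing_pairs d0 d2 dm n0.
Qed.

(** The expansion of F(y) reaches one exponent further than that of [y] from
    which it is computed. Every weight is an exponent: the pairs of weight at
    most mut N.+1 add up to the forcing terms, the others are negligible. *)
Lemma forcing_expansion : small (mut N.+1 + ls)
  (fun t => F (y t) - \sum_(1 <= n < N.+2) expR (- (mut n + ls) * t) *: forcing q n t).
Proof.
have [m [dlt [d0 d2 ed dm]]] := trunc_ex.
pose term p t := expR (- (weight p + ls) * t) *: coef p t.
have h1 : small (mut N.+1 + ls) (fun t => F (y t) - \sum_(p <- pairs m) term p t).
  apply: (@small_eq _ _ _ (fun t => (F (y t) - \sum_(1 <= r < M.+1) G r (y t)) +
    \sum_(r <- index_iota 1 M.+1) (G r (y t) - \sum_(s <- short_words I m)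
      expR (- (weight (r, s) + ls) * t) *: taylor_coef (G r) xi [seq q k t | k <- s]))).
    by move=> t; rewrite sumrB addrA subrK /pairs big_allpairs_dep.
  apply: smallD F_remainder _; apply: small_sum => r.
  rewrite mem_index_iota ltnS => /rangeM rK _.
  exact: G_expansion rK d0 ed dm.
have h2 : small (mut N.+1 + ls)
    (fun t => \sum_(p <- pairs m | mut N.+1 < weight p) term p t).
  apply: small_sum => p pm pw; apply: small_exp_polynomial.
    by rewrite ltrD2r.
  exact: coef_polynomial pm.
apply: small_eq (smallD h1 h2) => t; rewrite -addrA; congr (_ + _).
suff -> : \sum_(p <- pairs m) term p t =
    \sum_(1 <= n < N.+2) expR (- (mut n + ls) * t) *: forcing q n t +
    \sum_(p <- pairs m | mut N.+1 < weight p) term p t by rewrite opprD subrK.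
rewrite [X in _ + X]big_mkcond/= [X in X + _](_ : _ = \sum_(p <- pairs m)
  if weight p <= mut N.+1 then term p t else 0); last first.
  transitivity (\sum_(1 <= n < N.+2) \sum_(p <- pairs m) if weight p == mut n then
      term p t else 0).
    apply: eq_big_nat => n nN; rewrite (forcing_pairs _ d0 d2 dm nN).
    rewrite scaler_sumr big_mkcond; apply: eq_bigr => p _.
    by case: eqP => // pn; rewrite /term pn.
  rewrite exchange_big/=; apply: eq_big_seq => p /pairs_range[pK p2].
  have [k k0 kE] := weight_mut pK p2; rewrite kE.
  case: leP => [kN|Nk].
    have kN' : (k <= N.+1)%N.
      by rewrite leqNgt; apply/negP => /(mut_lt (ltn0Sn N)); rewrite ltNge kN.
    rewrite (bigD1_seq k) ?mem_index_iota ?iota_uniq ?k0//= eqxx.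
    rewrite big_seq_cond big1 ?addr0// => i.
    rewrite mem_index_iota => /andP[/andP[i0 _] ik]; case: eqP => // /mut_inj kk.
    by rewrite kk// eqxx in ik.
  rewrite big_nat_cond big1// => i /andP[/andP[i0 iN] _].
  by case: eqP => // ki; move: Nk; rewrite ki ltNge mut_le.
rewrite -big_split/=; apply: eq_bigr => p _.
by case: ltP => _; rewrite ?addr0 ?add0r.
Qed.

End Remainder.

Variables (A P : 'M[R]_d) (D : 'rV[R]_d).
Hypothesis Punit : P \in unitmx.
Hypothesis PA : P *m A = diag_mx D *m P.
Hypothesis Axi : A *m xi = ls *: xi.
Hypothesis Dmut : forall i, D ord0 i <= ls \/
  exists2 k, (0 < k)%N & D ord0 i - ls = mut k.
Variable y : R -> U.
Hypothesis dy : forall t : R, 0 < t -> is_derive t 1 y (F (y t) - A *m y t).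
Hypothesis y1 : small ls (fun t => y t - expR (- ls * t) *: xi).

Local Notation J := forcing.

Definition expansion_upto (N : nat) (q : nat -> R -> U) : Prop :=
  [/\ forall t, q 1%N t = xi,
      forall n, (0 < n <= N)%N -> vector_polynomial (q n),
      forall n, (0 < n <= N)%N -> Q_equation A ls xi K beta G mut q n &
      small (mut N + ls) (fun t => y t -
        \sum_(1 <= n < N.+1) expR (- (mut n + ls) * t) *: q n t)].

(** The terms G_1, ..., G_M include all those that can contribute at the
    exponent [mut n], and the error of approximation is negligible there. *)
Definition approximable_at (n : nat) : Prop :=
  exists M b, [/\ forall r, (0 < r <= M)%N -> in_range K r,
    forall r, in_range K r -> (beta r - 1) * ls <= mut n -> (r <= M)%N,
    remainder_bound F G M b, 0 <= b & mut n + ls < ls * b].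

Lemma expansion_upto_eq N q q' : (0 < N)%N ->
  (forall n, (0 < n <= N)%N -> q n = q' n) ->
  expansion_upto N q -> expansion_upto N q'.
Proof.
move=> N0 qq' [q1 vq Qq sq]; split.
- by move=> t; rewrite -qq'.
- by move=> n nN; rewrite -qq'//; exact: vq.
- move=> n nN t; have := Qq n nN t; rewrite -/(J q n t) -/(J q' n t) qq'// => ->.
  have /andP[n0 nN'] := nN.
  apply: forcing_eq => // k /andP[k0 kn]; apply: qq'.
  by rewrite k0 (leq_trans (ltnW kn)).
- apply: small_eq sq => t; congr (_ - _); apply: eq_big_nat => n nN.
  by rewrite qq'.
Qed.

Lemma expansion_upto1 : expansion_upto 1 (fun _ _ => xi).
Proof.
split=> //.
- by move=> n _; exact: vector_polynomial_cst.
- move=> n nN t; have -> : n = 1%N by case: n nN => [//|[//|n]]; rewrite ltnS.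
  rewrite -/(J (fun _ _ => xi) 1%N t) forcing1 mut1 add0r derive1_cst add0r.
  by rewrite mulmxBl mul_scalar_mx Axi subrr.
- rewrite mut1 add0r; apply: small_eq y1 => t.
  by rewrite big_nat1 mut1 add0r.
Qed.

Lemma diag_entry (w : U) i : (P *m (A *m w)) i ord0 = D ord0 i * (P *m w) i ord0.
Proof. by rewrite mulmxA PA -mulmxA mul_diag_mx mxE. Qed.

(** In the coordinates of P, the rescaled remainder z = e^{mu_{N+1} t} P w
    satisfies z_i' + (D_i - mu_{N+1}) z_i = (P J)_i + small, with J the next
    forcing term, so z is a polynomial solution of the same equation up to a
    small error; this polynomial is P q_{N+1}. *)
Lemma expansion_upto_step N q : (0 < N)%N -> approximable_at N.+1 ->
  expansion_upto N q ->
  exists q', (forall n, (0 < n <= N)%N -> q' n = q n) /\ expansion_upto N.+1 q'.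
Proof.
move=> N0 [M [b [rangeM resM Fb b0 lsb]]] [q1 vq Qq sq].
pose mu n := mut n + ls.
have Jv : vector_polynomial (J q N.+1).
  have := forcing_polynomial N0 vq sq rangeM resM.
  by move=> /(_ N.+1); rewrite leqnn; exact.
have FJ := forcing_expansion N0 vq q1 sq rangeM resM Fb b0 lsb.
pose w t := y t - \sum_(1 <= n < N.+1) expR (- mu n * t) *: q n t.
pose z i (t : R) : R := expR (mu N.+1 * t) * (P *m w t) i ord0.
have coord i : exists p : {poly R},
    (forall t, p^`().[t] + (D ord0 i - mu N.+1) * p.[t] = (P *m J q N.+1 t) i ord0) /\
    small 0 (fun t => z i t - p.[t]).
  have [jp jpE] : exists jp : {poly R}, forall t, (P *m J q N.+1 t) i ord0 = jp.[t].
    exact: vector_polynomial_entry (vector_polynomial_mulmx P Jv).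
  have pn_ex n : exists p : {poly R}, (0 < n <= N)%N ->
      forall t, (P *m q n t) i ord0 = p.[t] /\
        p^`().[t] + (D ord0 i - mu n) * p.[t] = (P *m J q n t) i ord0.
    have [nN|] := boolP (0 < n <= N)%N; last by exists 0.
    have [p pE] := vq n nN; exists ((map_mx polyC P *m p) i ord0) => _ t.
    have E : (P *m q n t) i ord0 = ((map_mx polyC P *m p) i ord0).[t].
      rewrite pE !mxE horner_sum; apply: eq_bigr => k _.
      by rewrite !mxE hornerM hornerC.
    split=> //; rewrite -E.
    have := Qq n nN t; rewrite -/(J q n t) => <-.
    rewrite mulmxDr mulmxBl mul_scalar_mx mulmxBr -scalemxAr.
    rewrite (vector_polynomial_derive t pE) entryD entryB diag_entry.
    rewrite mulrBl; congr (_ + _).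
    rewrite !mxE (big_morph _ (@derivD _) (@deriv0 _)) horner_sum; apply: eq_bigr => k _.
    by rewrite !mxE mul_polyC derivZ hornerZ.
  have [pn pnP] := choice pn_ex.
  pose u (t : R) : R := (P *m y t) i ord0.
  pose sp (t : R) : R := \sum_(n <- index_iota 1 N.+1) expR (- mu n * t) * (pn n).[t].
  have inN n : n \in index_iota 1 N.+1 -> (0 < n <= N)%N by rewrite mem_index_iota.
  have wE t : (P *m w t) i ord0 = u t - sp t.
    rewrite mulmxBr mulmx_sumr mxE; congr (_ + _).
    rewrite mxE summxE /sp; congr (- _); apply: eq_big_seq => n /inN nN.
    by rewrite -scalemxAr mxE; have [-> _] := pnP n nN t.
  pose dsp (t : R) : R := \sum_(n <- index_iota 1 N.+1)
    expR (- mu n * t) * ((pn n)^`().[t] - mu n * (pn n).[t]).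
  have du (t : R) : 0 < t -> is_derive t 1 u ((P *m F (y t)) i ord0 - D ord0 i * u t).
    move=> t0; have h := is_derive_mulmx_entry P i (dy t0).
    apply: (is_derive_eq h).
    by rewrite mulmxBr -[_ *m (A *m _)]scale1r entryB mul1r diag_entry.
  have dspP (t : R) : is_derive t 1 sp (dsp t).
    apply: is_derive_big => n _.
    apply: (is_derive_eq (is_derive_prod (is_derive_expRM _ _) (is_derive_poly _ _))).
    ring.
  pose r (t : R) : R := expR (mu N.+1 * t) * (P *m (F (y t) -
    \sum_(1 <= n < N.+2) expR (- mu n * t) *: J q n t)) i ord0.
  have rE t : r t = expR (mu N.+1 * t) * ((P *m F (y t)) i ord0
      - (dsp t + D ord0 i * sp t)) - jp.[t].
    rewrite /r mulmxBr mulmx_sumr -[\sum_(_ <= _ < _) _]scale1r entryB mul1r.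
    rewrite big_nat_recr//= entryD -scalemxAr entryZ jpE summxE.
    have -> : \sum_(1 <= n < N.+1) (P *m (expR (- mu n * t) *: J q n t)) i ord0
        = dsp t + D ord0 i * sp t.
      rewrite /dsp /sp mulr_sumr -big_split /=; apply: eq_big_seq => n /inN nN.
      rewrite -scalemxAr mxE; have [_ <-] := pnP n nN t; ring.
    have E : expR (mu N.+1 * t) * expR (- mu N.+1 * t) = 1.
      by rewrite -expRD -mulrDl subrr mul0r expR0.
    rewrite opprD addrA mulrBr mulrA E mul1r //.
  have zE : z i = (fun t => expR (mu N.+1 * t) * (u t - sp t)).
    by apply/funext => t; rewrite /z wE.
  have dz (t : R) : 0 < t ->
      is_derive t 1 (z i) (jp.[t] + r t - (D ord0 i - mu N.+1) * z i t).
    move=> t0; rewrite zE.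
    have dus : is_derive t 1 (fun s => u s - sp s)
      ((P *m F (y t)) i ord0 - D ord0 i * u t - dsp t).
      exact: is_deriveB (du t t0) (dspP t).
    apply: (is_derive_eq (is_derive_prod (is_derive_expRM _ _) dus)).
    rewrite rE; ring.
  have r0 : small 0 r.
    have h := small_entry i ord0 (small_mulmx P FJ).
    have := smallZexp (- mu N.+1) h; rewrite addNr.
    by apply: small_eq => t; rewrite /r opprK.
  (* An eigenvalue below mu N.+1 is at most mu N, since those above ls are
     exponents; so the mode e^{- D_i t} does not occur in the remainder. *)
  have za : D ord0 i - mu N.+1 < 0 ->
      small 0 (fun t => expR ((D ord0 i - mu N.+1) * t) * z i t).
    move=> Dmu; have DN : D ord0 i <= mut N + ls.
      have [Dls|[k k0 kE]] := Dmut i.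
        by rewrite (le_trans Dls)// lerDr mut_ge0.
      rewrite -lerBlDr kE mut_le// -ltnS mut_lt_inv// -kE.
      by move: Dmu; rewrite /mu subr_lt0 -ltrBlDr.
    have h := small_entry i ord0 (small_mulmx P sq).
    have := smallZexp (- D ord0 i) h.
    move=> /(@small_le _ _ 0) h'.
    apply: small_eq (h' _) => [t|]; last by rewrite addrC subr_ge0.
    rewrite /z mulrA -expRD opprK -mulrDl subrK //.
  have [p [pE ps]] := scalar_ode_expansion dz r0 za.
  exists p; split=> // t; rewrite jpE -pE !hornerE //.
have [p pP] := choice coord.
pose qn t : U := invmx P *m (\col_i (p i).[t]).
have Pqn t : P *m qn t = \col_i (p i).[t] by rewrite mulKVmx.
have qnE t : qn t = map_mx (horner^~ t) (map_mx polyC (invmx P) *m \col_i p i).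
  apply/matrixP => i j; rewrite !mxE horner_sum; apply: eq_bigr => k _.
  by rewrite !mxE hornerM hornerC.
have vqn : vector_polynomial qn by eexists; exact: qnE.
have dqn t : derive1 qn t = invmx P *m \col_i (p i)^`().[t].
  rewrite (vector_polynomial_derive t qnE); apply/matrixP => i j.
  rewrite !mxE (big_morph _ (@derivD _) (@deriv0 _)) horner_sum.
  by apply: eq_bigr => k _; rewrite !mxE mul_polyC derivZ hornerZ.
pose q' n := if n == N.+1 then qn else q n.
have q'q n : (0 < n <= N)%N -> q' n = q n.
  by move=> /andP[_ nN]; rewrite /q' ltn_eqF// ltnS.
have q'N : q' N.+1 = qn by rewrite /q' eqxx.
have [q'1 vq' Qq' sq'] : expansion_upto N q'.
  by apply: (expansion_upto_eq N0 _ (And4 q1 vq Qq sq)) => n nN; rewrite q'q.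
have cases n : (0 < n <= N.+1)%N -> (0 < n <= N)%N \/ n = N.+1.
  move=> /andP[n0]; rewrite leq_eqVlt ltnS => /orP[/eqP ->|nN]; first by right.
  by left; rewrite n0.
exists q'; split=> //; split=> //.
- by move=> n /cases[/vq' //|->]; rewrite q'N.
- move=> n /cases[/Qq' //|-> t].
  rewrite -/(J q' N.+1 t).
  have -> : J q' N.+1 t = J q N.+1 t.
    exact: (forcing_eq t (ltn0Sn N) q'q).
  rewrite q'N; apply: (can_inj (mulKmx Punit)).
  rewrite mulmxDr mulmxBl mul_scalar_mx mulmxBr -scalemxAr Pqn.
  apply/colP => i; rewrite entryD entryB diag_entry Pqn.
  have [<- _] := pP i; rewrite mulrBl.
  by rewrite dqn mulKVmx// !mxE.
- apply: (@small_eq _ _ _ (fun t => expR (- mu N.+1 * t) *: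
     (invmx P *m (\col_i (z i t - (p i).[t]))))).
    move=> t; rewrite [in RHS]big_nat_recr//= q'N.
    have -> : \col_i (z i t - (p i).[t]) =
        P *m (expR (mu N.+1 * t) *: w t) - P *m qn t.
      rewrite Pqn -[\col_i (p i).[t]]scale1r; apply/colP => i.
      by rewrite entryB -scalemxAr entryZ !mul1r [LHS]mxE [X in _ = _ - X]mxE.
    rewrite mulmxBr !mulKmx// scalerBr scalerA.
    rewrite -expRD -mulrDl addNr mul0r expR0 scale1r /w -addrA -opprD.
    congr (_ - (_ + _)); apply: eq_big_nat => n nN; rewrite q'q//.
  rewrite -[mut N.+1 + ls]addr0; apply: smallZexp; apply: small_mulmx.
  apply: small_entries => i; have [_] := pP i.
  by apply: small_eq => t; rewrite mxE.
Qed.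

(** Successive choices of the next coefficient. The predicate [ok] delimits
    the orders that can be reached: all of them for a complete approximation,
    finitely many otherwise. *)
Lemma expansion_exists (ok : nat -> Prop) :
  (forall N, (0 < N)%N -> ok N.+1 -> ok N /\ approximable_at N.+1) ->
  exists q, forall N, (0 < N)%N -> ok N -> expansion_upto N q.
Proof.
move=> okS.
have step (p : nat * (nat -> R -> U)) : exists q', (0 < p.1)%N ->
    approximable_at p.1.+1 -> expansion_upto p.1 p.2 ->
    (forall n, (0 < n <= p.1)%N -> q' n = p.2 n) /\ expansion_upto p.1.+1 q'.
  have [[h0 h1 h2]|h] := pselect ([/\ (0 < p.1)%N, approximable_at p.1.+1 &
      expansion_upto p.1 p.2]).
    by have [q' hq'] := expansion_upto_step h0 h1 h2; exists q'.
  by exists p.2 => h0 h1 h2; exfalso; apply: h.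
have [nx nxP] := choice step.
pose Qs := fix Qs k := if k is k'.+1 then nx (k'.+1, Qs k') else fun _ _ => xi.
have good k : ok k.+1 -> expansion_upto k.+1 (Qs k).
  elim: k => [_|k IH okk]; first exact: expansion_upto1.
  have [ok1 ap] := okS k.+1 isT okk.
  by have [] := nxP (k.+1, Qs k) isT ap (IH ok1).
have agree k n : ok k.+2 -> (0 < n <= k.+1)%N -> Qs k.+1 n = Qs k n.
  move=> okk; have [ok1 ap] := okS k.+1 isT okk.
  by have [+ _] := nxP (k.+1, Qs k) isT ap (good _ ok1); exact.
exists (fun n => Qs n.-1 n) => -[//|k] _ okk.
apply: (@expansion_upto_eq k.+1 (Qs k)) => //; last exact: good.
elim: k okk => [_ n|k IH okk n].
  by rewrite andbC => /andP[]; case: n => [|[|]].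
move=> /andP[n0]; rewrite leq_eqVlt ltnS => /orP[/eqP -> //|nk].
have [ok1 _] := okS k.+1 isT okk.
by rewrite agree ?n0//; apply: IH => //; rewrite n0.
Qed.

End Expansion.

(** * Decay of solutions and their leading term *)

Section Solutions.
Context {R : realType} {d : nat}.
Local Notation U := 'cV[R]_d.

Lemma near_powR_small (b C eta : R) : 1 < b -> 0 < C -> 0 < eta ->
  exists2 r : R, 0 < r & forall x : R, 0 <= x < r -> C * x `^ b <= eta * x.
Proof.
move=> b1 C0 eta0; have b10 : 0 < b - 1 by rewrite subr_gt0.
exists ((eta / C) `^ (b - 1)^-1) => [|x /andP[x0 xr]].
  by rewrite powR_gt0// divr_gt0.
rewrite -(mulr_powRB1 x0); last by rewrite (lt_trans _ b1).
rewrite mulrCA mulrC ler_wpM2r// mulrC -ler_pdivlMr//.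
apply: (@le_trans _ _ (((eta / C) `^ (b - 1)^-1) `^ (b - 1))).
  by apply: ge0_ler_powR; rewrite ?nnegrE ?powR_ge0 ?(ltW b10) ?(ltW xr).
by rewrite -powRrM mulVf ?gt_eqF// powRr1// divr_ge0// ltW.
Qed.

Variables (A : 'M[R]_d) (F : U -> U) (y : R -> U).
Hypothesis sol : is_solution A F y.

Lemma solution_is_derive (t : R) : 0 < t -> is_derive t 1 y (F (y t) - A *m y t).
Proof.
case: sol => -[dy [_ dyP _]] eqn t0; have yd := dyP t t0.
have E : derive1 y t = dy t by rewrite derive1E; exact: derive_val.
by rewrite -(eqn t t0) E addrK.
Qed.

Lemma solution_coord (P : 'M[R]_d) (D : 'rV[R]_d) i (t : R) :
  P *m A = diag_mx D *m P -> 0 < t ->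
  is_derive t 1 (fun s => (P *m y s) i ord0)
    ((P *m F (y t)) i ord0 - D ord0 i * (P *m y t) i ord0).
Proof.
move=> PA t0; have h := is_derive_mulmx_entry P i (solution_is_derive t0).
apply: (is_derive_eq h).
by rewrite mulmxBr mxE [X in _ + X]mxE (diag_entry PA).
Qed.

Lemma norm_le_unit (P : 'M[R]_d) (v : U) : P \in unitmx ->
  `|v| <= d%:R * `|invmx P| * `|P *m v|.
Proof. by move=> Pu; rewrite -{1}[v](mulKmx Pu); exact: ler_norm_mulmx. Qed.

Lemma diag_eigenvalue (P : 'M[R]_d) (D : 'rV[R]_d) i : P \in unitmx ->
  P *m A = diag_mx D *m P -> eigenvalue A (D ord0 i).
Proof.
move=> Pu PA; apply/eigenvalueP; exists (row i P).
  by rewrite -row_mul PA mul_diag_mx; apply/rowP => j; rewrite !mxE.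
apply/eqP => /(congr1 (mulmx^~ (invmx P))); rewrite rowE mulmxK// mul0mx.
by move=> /matrixP/(_ 0 i); rewrite !mxE !eqxx => /eqP; rewrite oner_eq0.
Qed.

Lemma unitmx_neq0 (P : 'M[R]_d) (v : U) : P \in unitmx -> v != 0 -> P *m v != 0.
Proof.
move=> Pu; apply: contra => /eqP Pv0.
by rewrite -[v](mulKmx Pu) Pv0 mulmx0.
Qed.

Lemma linear_bound_coord (P : 'M[R]_d) (L : R) (v : U) : P \in unitmx ->
  0 <= L -> `|F v| <= L * `|v| ->
  `|P *m F v| <= d%:R * `|P| * L * (d%:R * `|invmx P|) * `|P *m v|.
Proof.
move=> Pu L0 Fv; apply: (le_trans (ler_norm_mulmx _ _)).
rewrite -!mulrA ler_wpM2l// ler_wpM2l// (le_trans Fv)// ler_wpM2l//.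
by rewrite mulrA norm_le_unit.
Qed.

(** On a bounded time interval F(y) = O(|y|): where [y] is small because F is
    superlinear, elsewhere by compactness. So the energy cannot reach 0. *)
Lemma nonvanishing (P : 'M[R]_d) (D : 'rV[R]_d) (b s : R) :
  P \in unitmx -> P *m A = diag_mx D *m P -> 1 < b -> superlinear F b ->
  continuous F -> 0 < s -> y s != 0 -> forall t, s <= t -> y t != 0.
Proof.
move=> Pu PA b1 [r [C [r0 C0 FC]]] cF s0 ys t st.
have [r' r'0 r'P] := near_powR_small b1 C0 ltr01.
pose rho := Num.min r r'.
have rho0 : 0 < rho by rewrite lt_min r0.
have yc (x : R) : 0 < x -> {for x, continuous y}.
  move=> x0; apply: differentiable_continuous; apply/derivable1_diffP.
  by have [] := solution_is_derive x0.
have cont : {within `[s, t], continuous (fun x => `|F (y x)|)}.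
  apply: continuous_in_subspaceT => x; rewrite inE/= in_itv/= => /andP[sx _].
  apply: (@continuous_comp _ _ _ (fun x => F (y x)) (fun v : U => `|v|)).
    apply: continuous_comp; last exact: cF.
    by apply: yc; exact: lt_le_trans sx.
  exact: norm_continuous.
have [c _ cmax] := EVT_max st cont.
pose m := `|F (y c)|.
pose L := Num.max 1 (m / rho).
have L0 : 0 <= L by rewrite le_max ler01.
have FL x : s <= x <= t -> `|F (y x)| <= L * `|y x|.
  move=> xst; have [yr|yr] := ltP `|y x| rho.
    apply: (@le_trans _ _ (1 * `|y x|)); last first.
      by rewrite ler_wpM2r// le_max lexx.
    move: yr; rewrite lt_min => /andP[yr yr'].
    by apply: (le_trans (FC _ yr)); apply: r'P; rewrite normr_ge0.
  apply: (@le_trans _ _ (m / rho * rho)).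
    by rewrite divfK ?gt_eqF//; apply: cmax; rewrite in_itv.
  apply: ler_pM => //; last by rewrite le_max lexx orbT.
    by apply: divr_ge0; [exact: normr_ge0|exact: ltW].
  exact: ltW.
pose L' := d%:R * `|P| * L * (d%:R * `|invmx P|).
have L'0 : 0 <= L' by rewrite !mulr_ge0.
have [c0 [K [c00 low]]] := @energy_lower_bound R d (fun t => P *m y t)
  (fun t => P *m F (y t)) (fun i => D ord0 i) s L' s0 L'0
  (fun i t t0 => solution_coord i PA t0) (unitmx_neq0 Pu ys).
have := low t st (fun x xst => linear_bound_coord Pu L0 (FL x xst)).
apply: contraTneq => ->.
have -> : energy (P *m 0 : U) = 0.
  by rewrite mulmx0 /energy big1// => i _; rewrite mxE expr0n.
by rewrite -ltNge mulr_gt0// expR_gt0.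
Qed.

(** Only a one-sided derivative is available at 0, so the solution is first
    moved to a positive time. *)
Lemma initial_nonzero : y 0 != 0 -> exists2 s : R, 0 < s & y s != 0.
Proof.
case: sol => -[dy [_ _ dy0]] _ y0; apply: contrapT => h.
have yz s : 0 < s -> y s = 0.
  by move=> s0; apply/eqP; apply: contrapT => ys; apply: h; exists s => //; exact/negP.
have lim0 : h *: (h^-1 *: (y h - y 0)) @[h --> (0:R)^'+] --> (0 : R) *: dy 0.
  apply: cvgZ dy0; apply: cvg_at_right_filter; exact: cvg_id.
have limy : h *: (h^-1 *: (y h - y 0)) @[h --> (0:R)^'+] --> - y 0.
  apply: (@cvg_trans _ ((fun=> - y 0) @ (0:R)^'+)); last exact: cvg_cst.
  apply: near_eq_cvg; near=> s.
  have s0 : 0 < s by near: s; exact: nbhs_right_gt.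
  by rewrite scalerA divff ?gt_eqF// scale1r (yz s s0) sub0r.
have : (0 : R) *: dy 0 = - y 0 by exact: (cvg_unique _ lim0 limy).
by rewrite scale0r => /esym/eqP; rewrite oppr_eq0 (negbTE y0).
Unshelve. all: by end_near. Qed.

Lemma leading_exists (dstar : nat) (lam : nat -> R) (b : R) :
  diagonalizable A -> (forall a : R, eigenvalue A a -> 0 < a) ->
  distinct_eigenvalues A dstar lam -> 1 < b -> superlinear F b ->
  y t @[t --> +oo] --> (0 : U) ->
  (forall T : R, exists2 s, T < s & y s != 0) ->
  exists n0 xi, [/\ (0 < n0 <= dstar)%N, eigenvector A (lam n0) xi &
    small (lam n0) (fun t => y t - expR (- lam n0 * t) *: xi)].
Proof.
move=> [P Pu /diagonalizable_forPex[D /(simmxP Pu) PA]] Apos [lam_mono lamP] b1.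
move=> [r [C [r0 C0 FC]]] y0 ynz.
have Deig i := diag_eigenvalue i Pu PA.
pose u t := P *m y t; pose f t := P *m F (y t).
have ud i (t : R) : 0 < t -> is_derive t 1 (fun s => u s i ord0)
   (f t i ord0 - D ord0 i * u t i ord0) by exact: solution_coord.
have ylt (e : R) : 0 < e -> \forall t \near +oo, `|y t| < e.
  move=> e0; have /cvgrPdist_lt/(_ _ e0) := y0.
  by apply: filterS => t; rewrite sub0r normrN.
have Feta (eta : R) : 0 < eta -> \forall t \near +oo, `|F (y t)| <= eta * `|y t|.
  move=> eta0; have [r' r'0 r'P] := near_powR_small b1 C0 eta0.
  apply: filterS2 (ylt _ r0) (ylt _ r'0) => t yr yr'.
  by apply: (le_trans (FC _ yr)); apply: r'P; rewrite normr_ge0.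
pose kap := d%:R * `|P| * (d%:R * `|invmx P|).
have kap0 : 0 <= kap by rewrite !mulr_ge0.
have feta (eta : R) : 0 < eta -> \forall t \near +oo, `|f t| <= eta * `|u t|.
  move=> eta0; pose eta' := eta / (kap + 1).
  have kap1 : 0 < kap + 1 by rewrite ltr_wpDl.
  have eta'0 : 0 < eta' by rewrite divr_gt0.
  apply: filterS (Feta _ eta'0) => t /(linear_bound_coord Pu (ltW eta'0)) h.
  apply: (le_trans h); rewrite ler_wpM2r//.
  have -> : d%:R * `|P| * eta' * (d%:R * `|invmx P|) = kap * eta' by rewrite /kap; ring.
  rewrite /eta' mulrA ler_pdivrMr// mulrC ler_wpM2l ?(ltW eta0)//.
  by rewrite lerDl.
have fpow : \forall t \near +oo,
    `|f t| <= (d%:R * `|P| * C * (d%:R * `|invmx P|) `^ b) * `|u t| `^ b.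
  apply: filterS (ylt _ r0) => t /FC h.
  apply: (le_trans (ler_norm_mulmx _ _)).
  rewrite -!mulrA ler_wpM2l// ler_wpM2l// (le_trans h)// ler_wpM2l ?(ltW C0)//.
  rewrite -powRM ?mulr_ge0//; apply: ge0_ler_powR; rewrite ?nnegrE ?mulr_ge0//.
    by rewrite ltW// (lt_trans _ b1).
  exact: norm_le_unit.
have lam1 : exists2 l : R, 0 < l & forall i, l <= D ord0 i.
  have [|m mr mP] := @seq_min R (1 :: [seq D ord0 i | i <- enum 'I_d]) 1.
    exact: mem_head.
  exists m.
    move: mr; rewrite inE => /orP[/eqP ->//|/mapP[i _ ->]]; exact: Apos.
  move=> i; apply: mP; rewrite inE; apply/orP; right; apply: map_f.
  by rewrite mem_enum.
have [l l0 lD] := lam1.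
have ua0 := energy_decay l0 lD ud feta.
have [T T0 TF] := near_pinfty_ex (Feta 1 ltr01).
have [s Ts ys] := ynz T.
have s0 : 0 < s by exact: le_lt_trans Ts.
pose L' := d%:R * `|P| * 1 * (d%:R * `|invmx P|).
have L'0 : 0 <= L' by rewrite !mulr_ge0.
have [c [K [c0 low]]] := energy_lower_bound s0 L'0 ud (unitmx_neq0 Pu ys).
have low' : \forall t \near +oo, c * expR (- K * t) <= energy (u t).
  near=> t; apply: low; first by near: t; exact: near_pinfty_ge.
  move=> x /andP[sx _]; apply: linear_bound_coord => //.
  by apply: TF; exact: lt_le_trans sx.
have l20 : 0 < l / 2 by rewrite divr_gt0.
have [i0 [xi [xi0 xiD lead]]] := leading_diagonal l20 b1 ud fpow ua0 c0 low'.
have [n0 n0P lamE] := (lamP _).1 (Deig i0).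
exists n0, (invmx P *m xi); rewrite -lamE; split=> //.
  split.
    by apply: unitmx_neq0 => //; rewrite unitmx_inv.
  apply: (can_inj (mulKmx Pu)).
  rewrite mulmxA PA -mulmxA mulKVmx// -scalemxAr mulKVmx//.
  apply/colP => i; rewrite mul_diag_mx !mxE.
  by have [->//|/xiD ->] := eqVneq (D ord0 i) (D ord0 i0); rewrite !mulr0.
have := small_mulmx (invmx P) lead.
by apply: small_eq => t; rewrite mulmxBr mulKmx// -scalemxAr.
Unshelve. all: by end_near. Qed.

End Solutions.

(** * The expansion of a solution *)

Section Assembly.
Context {R : realType} {d : nat}.
Local Notation U := 'cV[R]_d.
Variables (A : 'M[R]_d) (dstar : nat) (lam : nat -> R) (V : set U).
Variables (F : U -> U) (K : option nat) (beta : nat -> R) (G : nat -> U -> U).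
Hypothesis Adiag : diagonalizable A.
Hypothesis Apos : forall a : R, eigenvalue A a -> 0 < a.
Hypothesis hlam : distinct_eigenvalues A dstar lam.
Hypothesis oV : open V.
Hypothesis hV : forall (a : R) (v : U), eigenvector A a v -> V v.
Hypothesis Fcont : continuous F.
Hypothesis hG : approx_terms V K beta G.
Hypothesis range1 : in_range K 1.
Hypothesis beta_fin : forall B : R, exists J, forall j, in_range K j ->
  beta j <= B -> (j < J)%N.

Lemma superlinear_approx M (b : R) : (0 < M)%N ->
  (forall r, (0 < r <= M)%N -> in_range K r) -> beta 1%N <= b ->
  remainder_bound F G M b -> superlinear F (beta 1%N).
Proof.
move=> M0 rM bb Fb; case: hG => b1 bm homG _.
apply: (@superlinear_bound R d F beta G M b) => //.
- exact: lt_trans (b1 _ range1).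
- move=> j k j0 jk kM; apply: bm => //; apply: rM.
    by rewrite j0 (leq_trans (ltnW jk)).
  by rewrite kM (leq_ltn_trans _ jk).
- by move=> k /rM; exact: homG.
- exact: Fcont.
Qed.

Variable y : R -> U.
Hypothesis sol : is_solution A F y.
Hypothesis y_to0 : y t @[t --> +oo] --> (0 : U).
Hypothesis Fsup : superlinear F (beta 1%N).

Lemma recurrently_nonzero : y 0 != 0 -> forall T : R, exists2 s, T < s & y s != 0.
Proof.
move=> y0 T; have [s s0 ys] := initial_nonzero sol y0.
have [P Pu /diagonalizable_forPex[D /(simmxP Pu) PA]] := Adiag.
exists (Num.max s T + 1); first by rewrite ltr_pwDr// le_max lexx orbT.
case: hG => b1 _ _ _.
apply: (nonvanishing sol Pu PA (b1 _ range1) Fsup Fcont s0 ys).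
by apply: ler_wpDr => //; rewrite le_max lexx.
Qed.

(** The part common to all kinds of approximation. What distinguishes them is
    the set [ok] of orders at which F is approximated well enough. *)
Lemma solution_expansion :
  (forall T : R, exists2 s, T < s & y s != 0) ->
  exists n0, (0 < n0 <= dstar)%N /\ exists xi, leading_term A (lam n0) xi y /\
  exists mut, enumerates mut (Stilde dstar lam n0 K beta) /\
  [/\ 0 < lam n0, mut 1%N = 0, forall B, exists2 n, (0 < n)%N & B < mut n &
   forall ok : nat -> Prop,
    (forall N, (0 < N)%N -> ok N.+1 -> ok N /\
      approximable_at F K beta G (lam n0) mut N.+1) ->
    exists q, forall N, (0 < N)%N -> ok N ->
      [/\ forall n, (0 < n <= N)%N -> vector_polynomial (q n),
          forall n, (0 < n <= N)%N -> Q_equation A (lam n0) xi K beta G mut q n &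
          partial_expansion (lam n0) mut q N y]].
Proof.
move=> ynz; have [b1 _ _ _] := hG; have [lam_mono lamP] := hlam.
have [n0 [xi [n0P eig lead]]] :=
  leading_exists sol Adiag Apos hlam (b1 _ range1) Fsup y_to0 ynz.
have ls0 : 0 < lam n0 by apply: Apos; apply/lamP; exists n0.
have lm j k : (0 < j)%N -> (j < k)%N -> (k <= dstar)%N -> lam j < lam k.
  exact: lam_mono.
have rfin (B : R) : exists J, forall j, in_range K j ->
    (beta j - 1) * lam n0 <= B -> (j < J)%N.
  have [J JP] := beta_fin (B / lam n0 + 1); exists J => j jK jB.
  by apply: JP => //; rewrite -lerBlDr ler_pdivlMr.
have [mut mutE mut1] := Stilde_enumeration lm n0P ls0 b1 range1 rfin.
have [mutS mutP] := mutE.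
exists n0; split=> //; exists xi; split.
  split=> //; have [e e0 he] := lead; exists e => //.
  exact/bigO_inftyP.
exists mut; split=> //; split=> //.
  move=> B; have [s Ss Bs] := Stilde_unbounded lm n0P ls0 b1 range1 B.
  by have [n nn sE] := (mutP s).1 Ss; exists n; rewrite -?sE.
have Smut n : (0 < n)%N -> Stilde dstar lam n0 K beta (mut n).
  by move=> nn; apply/mutP; exists n.
have mutD i j : (0 < i)%N -> (0 < j)%N ->
    exists2 k, (0 < k)%N & mut i + mut j = mut k.
  by move=> i0 j0; apply/mutP; apply: Stilde_add; exact: Smut.
have mutG r : in_range K r -> exists2 k, (0 < k)%N & (beta r - 1) * lam n0 = mut k.
  by move=> rK; apply/mutP; apply: Stilde_generator; right; exists r.
have [P Pu /diagonalizable_forPex[D /(simmxP Pu) PA]] := Adiag.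
have Dmut i : D ord0 i <= lam n0 \/
    exists2 k, (0 < k)%N & D ord0 i - lam n0 = mut k.
  have [k /andP[k0 kd] ->] := (lamP _).1 (diag_eigenvalue i Pu PA).
  have [kn|nk] := leqP k n0.
    left; move: kn; rewrite leq_eqVlt => /orP[/eqP -> //|kn].
    by apply/ltW/lm => //; case/andP: n0P.
  right; apply/mutP; apply: Stilde_generator; left; exists k => //.
  by rewrite nk.
move=> ok okS.
have [q qP] := expansion_exists oV (hV eig) hG ls0 mutS mut1 mutD mutG Pu PA eig.2
  Dmut (solution_is_derive sol) lead okS.
exists q => N N0 okN; have [_ vq Qq sq] := qP N N0 okN; split=> //.
have [e e0 he] := sq; exists e => //; exact/bigO_inftyP.
Qed.

End Assembly.

Lemma beta_infty_fin (R : realType) (beta : nat -> R) : beta @ \oo --> +oo ->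
  forall B : R, exists J, forall j, in_range None j -> beta j <= B -> (j < J)%N.
Proof.
move=> /cvgryPgt bB B; have [J _ JP] := bB B.
exists J => j _ jB; rewrite ltnNge; apply/negP => /JP /=.
by rewrite ltNge jB.
Qed.

Lemma beta_some_fin (R : realType) (beta : nat -> R) Ns :
  forall B : R, exists J, forall j, in_range (Some Ns) j -> beta j <= B -> (j < J)%N.
Proof. by move=> B; exists Ns.+1 => j /andP[_ jN] _. Qed.

Section Conclusions.
Context {R : realType} {d : nat}.
Local Notation U := 'cV[R]_d.
Variables (A : 'M[R]_d) (dstar : nat) (lam : nat -> R) (V : set U).
Variables (F : U -> U) (beta : nat -> R) (G : nat -> U -> U).
Hypothesis Adiag : diagonalizable A.
Hypothesis Apos : forall a : R, eigenvalue A a -> 0 < a.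
Hypothesis hlam : distinct_eigenvalues A dstar lam.
Hypothesis oV : open V.
Hypothesis hV : forall (a : R) (v : U), eigenvector A a v -> V v.
Hypothesis Fcont : continuous F.
Variable y : R -> U.
Hypothesis sol : is_solution A F y.
Hypothesis y_to0 : y t @[t --> +oo] --> (0 : U).

(** The one form in which both complete approximations are used: for every [c]
    a partial sum that contains all terms of degree at most [c], with a
    remainder of degree above [c]. *)
Lemma full_approx_data K : full_approx V F K beta G ->
  [/\ approx_terms V K beta G, in_range K 1,
      forall B : R, exists J, forall j, in_range K j -> beta j <= B -> (j < J)%N &
      forall c : R, exists M b, [/\ (0 < M)%N,
        forall r, (0 < r <= M)%N -> in_range K r,
        forall r, in_range K r -> beta r <= c -> (r <= M)%N,
        remainder_bound F G M b & c < b /\ beta 1%N <= b]].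
Proof.
case: K => [Ns|] /=.
  move=> [Ns0 hG Fb]; split=> //; first exact: beta_some_fin.
  move=> c; exists Ns, (Num.max (beta Ns) c + 1); split=> //.
  - by move=> r /andP[_].
  - by apply: Fb; rewrite ltr_pwDr// le_max lexx.
  - split; first by rewrite ltr_pwDr// le_max lexx orbT.
    rewrite ler_wpDr// le_max; apply/orP; left; case: hG => _ bm _ _.
    case: Ns Ns0 bm {Fb} => [//|[//|N]] _ bm.
    by apply: ltW; apply: bm; rewrite /in_range /= ?leqnn.
move=> [hG binf Fb]; have fin := beta_infty_fin binf; split=> //.
move=> c; have [J JP] := fin (Num.max (beta 1%N) c).
have cJ : Num.max (beta 1%N) c < beta J.+1.
  by rewrite ltNge; apply/negP => /(JP J.+1 isT); rewrite ltnNge leqnSn.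
have [b Jb FbJ] := Fb J.+1 isT.
have cb := lt_trans cJ Jb; move: cJ cb; rewrite !gt_max => /andP[_ cJ] /andP[b1 cb].
exists J.+1, b; split=> //.
- by move=> r /andP[r0 _]; rewrite /in_range r0.
- move=> r rK rc; rewrite leqNgt; apply/negP => Jr; case: hG => _ bm _ _.
  by have := bm J.+1 r isT rK Jr; rewrite ltNge (le_trans rc)// ltW.
- by split=> //; exact: ltW.
Qed.

Lemma full_superlinear K : full_approx V F K beta G -> superlinear F (beta 1%N).
Proof.
move=> /full_approx_data[hG K1 _ ap]; have [M [b [M0 rM _ Fb [_ bb]]]] := ap 0.
exact: (superlinear_approx Fcont hG K1 M0 rM bb Fb).
Qed.

Lemma full_expansion K : full_approx V F K beta G ->
  (forall T : R, exists2 s, T < s & y s != 0) ->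
  infinite_expansion_property A dstar lam K beta G y.
Proof.
move=> fa ynz; have [hG K1 fin ap] := full_approx_data fa.
have [n0 [n0P [xi [lead [mut [mutE [ls0 mut1 _ ex]]]]]]] :=
  solution_expansion Adiag Apos hlam oV hV hG K1 fin sol y_to0 (full_superlinear fa) ynz.
exists n0; split=> //; exists xi; split=> //; exists mut; split=> //.
have [//|q qP] := ex (fun=> True).
  move=> N N0 _; split=> //.
  have [M [b [M0 rM resM Fb [cb _]]]] := ap ((mut N.+1 + lam n0) / lam n0).
  exists M, b; split=> //.
  - move=> r rK rN; apply: resM => //; rewrite ler_pdivlMr//.
    by move: rN; rewrite mulrBl mul1r lerBlDr.
  - apply: ltW; apply: le_lt_trans cb; rewrite divr_ge0 ?(ltW ls0)//.
    rewrite addr_ge0 ?(ltW ls0)//.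
    by have [mutS _] := mutE; exact: mut_ge0.
  - by rewrite mulrC -ltr_pdivrMr.
exists q; split=> n nn; have [vq Qq pq] := qP n nn I => //.
  by apply: vq; rewrite nn leqnn.
by apply: Qq; rewrite nn leqnn.
Qed.

Lemma finite_approx_data Ns eps : finite_approx V F Ns beta G eps ->
  [/\ approx_terms V (Some Ns) beta G, in_range (Some Ns) 1,
     1 < beta Ns & beta 1%N <= beta Ns + eps].
Proof.
move=> [Ns0 hG e0 Fb]; have [b1 bm _ _] := hG; split=> //.
  by apply: b1; rewrite /in_range Ns0 /=.
rewrite ler_wpDr ?(ltW e0)//.
case: Ns Ns0 bm {Fb hG b1} => [//|[//|N]] _ bm.
by apply: ltW; apply: bm; rewrite /in_range /= ?leqnn.
Qed.

Lemma finite_superlinear Ns eps : finite_approx V F Ns beta G eps ->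
  superlinear F (beta 1%N).
Proof.
move=> fa; have [hG K1 _ bb] := finite_approx_data fa; have [Ns0 _ _ Fb] := fa.
by apply: (superlinear_approx Fcont hG K1 Ns0 _ bb Fb).
Qed.

Lemma finite_expansion Ns eps : finite_approx V F Ns beta G eps ->
  (forall T : R, exists2 s, T < s & y s != 0) ->
  finite_expansion_property A dstar lam Ns beta G eps y.
Proof.
move=> fa ynz; have [hG K1 bN bb] := finite_approx_data fa.
have [Ns0 _ e0 Fb] := fa.
have [n0 [n0P [xi [lead [mut [mutE [ls0 mut1 unb ex]]]]]]] :=
  solution_expansion Adiag Apos hlam oV hV hG K1 (@beta_some_fin _ beta Ns) sol y_to0
    (finite_superlinear fa) ynz.
exists n0; split=> //; exists xi; split=> //; exists mut; split=> //.
have [mutS _] := mutE.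
pose B := lam n0 * (beta Ns + eps).
pose ok N := mut N + lam n0 < B.
have ok1 : ok 1%N.
  by rewrite /ok mut1 add0r /B ltr_pMr//; lra.
have [m m0 mB] := unb B.
have okm N : (0 < N)%N && ok N -> (N <= m)%N.
  move=> /andP[N0 okN]; rewrite leqNgt; apply/negP => mN.
  have := mut_lt mutS m0 mN; move: okN; rewrite /ok; lra.
have exN : exists N, (0 < N)%N && ok N by exists 1%N; rewrite ok1.
case: (ex_maxnP exN okm) => Nbar /andP[Nbar0 okN] Nmax.
exists Nbar; split.
  by split=> // N N0 okN'; apply: Nmax; rewrite N0.
have [|q qP] := ex ok.
  move=> N N0 okN1; split.
    by move: okN1; rewrite /ok; have := mutS N N0; lra.
  exists Ns, (beta Ns + eps); split=> //.
  - by move=> r /andP[_].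
  - by lra.
by exists q; have := qP Nbar Nbar0 okN.
Qed.

End Conclusions.

Theorem theorem5p3 (R : realType) (d : nat) (hd : (0 < d)%N)
    (A : 'M[R]_d) (Adiag : diagonalizable A)
    (Apos : forall a : R, eigenvalue A a -> 0 < a)
    (dstar : nat) (lam : nat -> R) (hlam : distinct_eigenvalues A dstar lam)
    (V : set 'cV[R]_d) (oV : open V)
    (hV : forall (a : R) (v : 'cV[R]_d), eigenvector A a v -> V v)
    (F : 'cV[R]_d -> 'cV[R]_d) :
  ((calX V F ->
      forall (K : option nat) (beta : nat -> R)
        (G : nat -> 'cV[R]_d -> 'cV[R]_d),
      full_approx V F K beta G ->
      forall y : R -> 'cV[R]_d, is_solution A F y -> y 0 != 0 ->
        y t @[t --> +oo] --> (0 : 'cV[R]_d) ->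
        infinite_expansion_property A dstar lam K beta G y)
   /\
   (calXhat V F ->
      forall (Ns : nat) (beta : nat -> R)
        (G : nat -> 'cV[R]_d -> 'cV[R]_d) (eps : R),
      finite_approx V F Ns beta G eps ->
      forall y : R -> 'cV[R]_d, is_solution A F y -> y 0 != 0 ->
        y t @[t --> +oo] --> (0 : 'cV[R]_d) ->
        finite_expansion_property A dstar lam Ns beta G eps y))
  /\
  (forall y : R -> 'cV[R]_d, is_solution A F y ->
     y t @[t --> +oo] --> (0 : 'cV[R]_d) ->
     (exists tn : nat -> R,
        [/\ forall n, 0 < tn n,
            forall n, tn n < tn n.+1,
            tn n @[n --> \oo] --> +oo &
            forall n, y (tn n) != 0]) ->
     (calX0 V F ->
        forall (K : option nat) (beta : nat -> R)
          (G : nat -> 'cV[R]_d -> 'cV[R]_d),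
        full_approx V F K beta G ->
        infinite_expansion_property A dstar lam K beta G y)
     /\
     (calXhat0 V F ->
        forall (Ns : nat) (beta : nat -> R)
          (G : nat -> 'cV[R]_d -> 'cV[R]_d) (eps : R),
        finite_approx V F Ns beta G eps ->
        finite_expansion_property A dstar lam Ns beta G eps y)).
Proof.
split.
  split=> [[/locally_lipschitz_continuous Fc _] K beta G fa y sol y0 yt|
           [/locally_lipschitz_continuous Fc _] Ns beta G eps fa y sol y0 yt].
    apply: (full_expansion Adiag Apos hlam oV hV Fc sol yt fa).
    have [hG K1 _ _] := full_approx_data fa.
    exact: (recurrently_nonzero Adiag Fc hG K1 sol (full_superlinear Fc fa) y0).
  apply: (finite_expansion Adiag Apos hlam oV hV Fc sol yt fa).
  have [hG K1 _ _] := finite_approx_data fa.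
  exact: (recurrently_nonzero Adiag Fc hG K1 sol (finite_superlinear Fc fa) y0).
move=> y sol yt [tn [_ _ tninf tnz]].
have ynz (T : R) : exists2 s, T < s & y s != 0.
  have [n _ nP] := (cvgryPgt tn).1 tninf T.
  by exists (tn n); [apply: nP => /=|exact: tnz].
split=> [[Fc _] K beta G fa|[Fc _] Ns beta G eps fa].
  exact: (full_expansion Adiag Apos hlam oV hV Fc sol yt fa).
exact: (finite_expansion Adiag Apos hlam oV hV Fc sol yt fa).
Qed.
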